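(* The following bounds hold: $$0 < Q(t) \le 2.714\,\frac{1}{t}e^{-t} \quad \text{for all } t \ge 2.5,$$ and $$3Q(t)^2 \le e^{-2t} \quad \text{for all } t \ge 5.$$
   Context: $Q(t)$, $t\ge 0$, denotes the radial profile of the positive radial ground state of $\Delta\phi - \phi + |\phi|^2\phi = 0$ on $\mathbb{R}^3$; it solves $-Q'' - \frac{2}{t}Q' + Q - Q^3 = 0$. *)

(* Defs.v *)
From Stdlib Require Import Reals Lra.
From Coquelicot Require Import Coquelicot.
Open Scope R_scope.

(* Q is the radial profile of the positive radial ground state of
   Delta phi - phi + |phi|^2 phi = 0 on R^3, i.e. phi(x) = Q(|x|).
   We represent the profile as a function on R extended evenly
   (Q(-t) = Q(t)), so that regularity at the origin of phi is encoded by Q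
   being twice differentiable on all of R (in particular Q'(0) = 0).
   The ground state is characterised as: positive, regular at 0, solving
   -Q'' - (2/t) Q' + Q - Q^3 = 0 for t > 0, and decaying to 0 at infinity.
   (Such a solution is unique by Coffman's theorem.) *)
Definition is_ground_state_profile (Q : R -> R) : Prop :=
  (forall t, Q (- t) = Q t) /\
  (forall t, ex_derive Q t) /\
  (forall t, ex_derive (Derive Q) t) /\
  (forall t, 0 <= t -> 0 < Q t) /\
  (forall t, 0 < t ->
     - Derive_n Q 2 t - (2 / t) * Derive Q t + Q t - (Q t) ^ 3 = 0) /\
  is_lim Q p_infty 0.

(* Main.v *)
Require Import Defs.
From Stdlib Require Import Reals.
From Coquelicot Require Import Coquelicot.
From Stdlib Require Import Lra ZArith List Classical.
Import ListNotations.
Open Scope R_scope.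

(* The reduced profile [u = t Q] solves [u'' = u - u^3/t^2], and [u e^t]
   increases to a finite limit [A]; everything reduces to [A <= 2.714] (the true
   value is about 2.7128).  Two one-sided arguments meet at [t = 1/2].

   Inside: the cube lies above its tangents, so testing the equation on [0, T]
   against a positive weight vanishing at 0 and [T] bounds [u(T)] from above.
   The weight [sin (PI t / T)] gives a bound for every [T]; at [T = 1/2], which is
   close to the first zero of the regular solution of the equation linearised at
   the ground state, a polynomial weight gives the nearly optimal
   [u(1/2) <= 1.2192].

   Outside: if [A > 5], then [u] would exceed the first of these bounds somewhere.
   Otherwise [u] is small enough for Sturm comparison on [1/2, oo) with an explicit
   [v] such that [v'' <= v - v^3/t^2] and [v e^t -> 2.714]: if [A > 2.714], then
   [u - v] is positive near infinity, hence everywhere on [1/2, oo), whereas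
   [v(1/2) > 1.2192]. *)

(** * Monotonicity from the sign of a derivative *)

Lemma nondecreasing_of_derive (f df : R -> R) (a b : R) : a <= b ->
  (forall t, a <= t <= b -> continuous f t) ->
  (forall t, a < t < b -> is_derive f t (df t)) ->
  (forall t, a < t < b -> 0 <= df t) -> f a <= f b.
Proof.
  intros Hab Hc Hd Hp.
  (* The mean value point may be an endpoint, where nothing is known of [df]; truncating at 0 gives
     the right sign there and leaves [df] unchanged inside. *)
  destruct (MVT_gen f a b (fun t => Rmax 0 (df t))) as [c [_ Hv]];
    rewrite ?(Rmin_left a b), ?(Rmax_right a b) by exact Hab.
  - intros t Ht; rewrite Rmax_right; auto.
  - intros t Ht; apply continuity_pt_filterlim, Hc, Ht.
  - pose proof (Rmax_l 0 (df c)); nra.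
Qed.

(** For an abstract function [auto_derive] leaves [Derive f x], with [f] possibly eta-expanded; both
    shapes are handled. *)
Ltac rewrite_derive H :=
  let T := type of H in
  match eval cbv beta in T with
  | is_derive ?f ?x ?l =>
      let E := fresh in
      assert (E : Derive f x = l) by (apply is_derive_unique; exact H);
      first [rewrite E | change (Derive (fun y : R => f y) x = l) in E; rewrite E];
      clear E
  end.

Lemma is_derive_continuous (f : R -> R) (t l : R) : is_derive f t l -> continuous f t.
Proof.
  intros H; apply (ex_derive_continuous (K := R_AbsRing) (V := R_NormedModule) f t).
  exists l; exact H.
Qed.

Lemma nondecreasing_of_is_derive (f df : R -> R) (a b : R) : a <= b ->
  (forall t, a <= t <= b -> is_derive f t (df t)) ->
  (forall t, a < t < b -> 0 <= df t) -> f a <= f b.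
Proof.
  intros Hab Hd Hp; apply (nondecreasing_of_derive f df a b Hab).
  - intros t Ht; apply (is_derive_continuous f t (df t)); auto.
  - intros t Ht; apply Hd; lra.
  - exact Hp.
Qed.

(** * Functions tending to 0 at infinity *)

Definition vanishes (f : R -> R) : Prop :=
  forall eps, 0 < eps -> exists M, forall t, M <= t -> Rabs (f t) < eps.

Lemma vanishes_ext (f g : R -> R) (M : R) :
  (forall t, M <= t -> f t = g t) -> vanishes f -> vanishes g.
Proof.
  intros Hfg Hf eps He; destruct (Hf eps He) as [N HN].
  exists (Rmax M N); intros t Ht.
  rewrite <- Hfg; [apply HN|]; eapply Rle_trans; try exact Ht;
    [apply Rmax_r | apply Rmax_l].
Qed.

Lemma vanishes_plus (f g : R -> R) :
  vanishes f -> vanishes g -> vanishes (fun t => f t + g t).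
Proof.
  intros Hf Hg eps He.
  destruct (Hf (eps / 2)) as [M HM]; [lra|].
  destruct (Hg (eps / 2)) as [N HN]; [lra|].
  exists (Rmax M N); intros t Ht.
  pose proof (Rmax_l M N); pose proof (Rmax_r M N).
  eapply Rle_lt_trans; [apply Rabs_triang|].
  specialize (HM t ltac:(lra)); specialize (HN t ltac:(lra)); lra.
Qed.

Lemma vanishes_mult_bounded (f g : R -> R) (C M : R) :
  (forall t, M <= t -> Rabs (g t) <= C) -> vanishes f -> vanishes (fun t => g t * f t).
Proof.
  intros Hg Hf eps He.
  destruct (Hf (eps / (Rabs C + 1))) as [N HN].
  { pose proof (Rabs_pos C); apply Rdiv_lt_0_compat; lra. }
  exists (Rmax M N); intros t Ht.
  pose proof (Rmax_l M N); pose proof (Rmax_r M N).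
  specialize (HN t ltac:(lra)); specialize (Hg t ltac:(lra)).
  rewrite Rabs_mult.
  pose proof (Rabs_pos (f t)); pose proof (Rabs_pos (g t)); pose proof (Rle_abs C).
  apply (Rmult_lt_compat_r (Rabs C + 1)) in HN; [|lra].
  replace (eps / (Rabs C + 1) * (Rabs C + 1)) with eps in HN by (field; lra).
  nra.
Qed.

Lemma vanishes_scal (f : R -> R) (c : R) : vanishes f -> vanishes (fun t => c * f t).
Proof.
  apply (vanishes_mult_bounded f (fun _ => c) (Rabs c) 0); intros; lra.
Qed.

Lemma vanishes_minus (f g : R -> R) :
  vanishes f -> vanishes g -> vanishes (fun t => f t - g t).
Proof.
  intros Hf Hg.
  apply (vanishes_ext (fun t => f t + (-1) * g t) _ 0); [intros; ring|].
  apply vanishes_plus; [exact Hf | now apply vanishes_scal].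
Qed.

Lemma vanishes_exp (c : R) : 0 < c -> vanishes (fun t => exp (- (c * t))).
Proof.
  intros Hc eps He; exists (/ (eps * c)); intros t Ht.
  assert (Hp : 0 < / (eps * c)) by (apply Rinv_0_lt_compat; nra).
  rewrite Rabs_pos_eq by (left; apply exp_pos).
  rewrite exp_Ropp.
  pose proof (exp_ineq1 (c * t) ltac:(nra)) as H1.
  apply (Rmult_le_compat_l (eps * c)) in Ht; [|nra].
  rewrite Rinv_r in Ht by nra.
  rewrite <- (Rinv_inv eps).
  apply Rinv_lt_contravar; [apply Rmult_lt_0_compat; [apply Rinv_0_lt_compat; lra|apply exp_pos]|].
  apply Rlt_trans with (2 := H1).
  apply Rmult_lt_reg_l with eps; [lra|]. rewrite Rinv_r by lra. lra.
Qed.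

Lemma vanishes_dominated (f g : R -> R) (M : R) :
  (forall t, M <= t -> Rabs (f t) <= g t) -> vanishes g -> vanishes f.
Proof.
  intros H Hg eps He; destruct (Hg eps He) as [N HN].
  exists (Rmax M N); intros t Ht.
  pose proof (Rmax_l M N); pose proof (Rmax_r M N).
  specialize (H t ltac:(lra)); specialize (HN t ltac:(lra)).
  pose proof (Rle_abs (g t)); lra.
Qed.

(** A nondecreasing function stays below its limit; this is how differential inequalities are
    integrated from infinity. *)
Lemma nondecreasing_vanishes_le_0 (f df : R -> R) (a : R) :
  (forall t, a <= t -> is_derive f t (df t)) ->
  (forall t, a < t -> 0 <= df t) -> vanishes f -> f a <= 0.
Proof.
  intros Hd Hp Hv; apply Rnot_lt_le; intros Hlt.
  destruct (Hv (f a) Hlt) as [M HM].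
  assert (H : f a <= f (Rmax a M)).
  { apply (nondecreasing_of_is_derive f df); [apply Rmax_l| |];
      intros t Ht; [apply Hd | apply Hp]; lra. }
  specialize (HM (Rmax a M) (Rmax_r a M)).
  pose proof (Rle_abs (f (Rmax a M))); lra.
Qed.

(** * Backward Sturm comparison *)

(** Continuous induction downwards: at the supremum [s] of the points with [h <= 0] the step gives
    [0 < h s], and continuity then lowers the supremum. *)
Lemma positive_backward (h : R -> R) (a b : R) : a <= b ->
  (forall t, a <= t <= b -> continuous h t) -> 0 < h b ->
  (forall s, a <= s < b -> (forall t, s < t <= b -> 0 < h t) -> 0 < h s) ->
  forall t, a <= t <= b -> 0 < h t.
Proof.
  intros Hab Hc Hb Hstep t0 Ht0; apply Rnot_le_lt; intros Hneg.
  destruct (completeness (fun x => a <= x <= b /\ h x <= 0)) as [s [Hs1 Hs2]].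
  - exists b; intros x [Hx _]; apply Hx.
  - exists t0; split; assumption.
  - assert (Has : a <= s) by (specialize (Hs1 t0 (conj Ht0 Hneg)); lra).
    assert (Hsb : s <= b) by (apply Hs2; intros x [Hx _]; apply Hx).
    assert (Hnb : forall x, s < x <= b -> 0 < h x).
    { intros x Hx; apply Rnot_le_lt; intros Hx0.
      assert (Hxab : a <= x <= b) by lra.
      specialize (Hs1 x (conj Hxab Hx0)); lra. }
    assert (Hhs : 0 < h s).
    { destruct (Req_dec s b) as [->|Hne]; [exact Hb|].
      apply Hstep; [lra | exact Hnb]. }
    (* [h] stays positive near [s], so a smaller upper bound exists *)
    destruct (proj1 (filterlim_locally h (h s)) (Hc s (conj Has Hsb))
               (mkposreal _ Hhs)) as [del Hdel].
    assert (Hub : is_upper_bound (fun x => a <= x <= b /\ h x <= 0) (s - del)).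
    { intros x [Hx Hx0]; apply Rnot_lt_le; intros Hlt.
      specialize (Hs1 x (conj Hx Hx0)).
      assert (Hball : ball s del x).
      { change (Rabs (x - s) < del); rewrite Rabs_left1; lra. }
      specialize (Hdel x Hball).
      change (Rabs (h x - h s) < h s) in Hdel.
      apply Rabs_def2 in Hdel; lra. }
    specialize (Hs2 _ Hub); pose proof (cond_pos del); lra.
Qed.

(* The Wronskian [p d' - p' d] is nondecreasing wherever [d > 0]; being
   nonpositive at [b], it makes [d / p] nonincreasing, so [d] cannot vanish. *)
Lemma sturm_backward (d d1 d2 p p1 p2 : R -> R) (a b : R) : a <= b ->
  (forall t, a <= t <= b -> is_derive d t (d1 t)) ->
  (forall t, a <= t <= b -> is_derive d1 t (d2 t)) ->
  (forall t, a <= t <= b -> is_derive p t (p1 t)) ->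
  (forall t, a <= t <= b -> is_derive p1 t (p2 t)) ->
  (forall t, a <= t <= b -> 0 < p t) ->
  (forall t, a < t < b -> 0 < d t -> p2 t * d t <= p t * d2 t) ->
  0 < d b -> d1 b * p b <= p1 b * d b ->
  0 < d a /\ d1 a * p a <= p1 a * d a.
Proof.
  intros Hab Hd Hd1 Hp Hp1 Hpos Hineq Hdb Hb.
  assert (HN : forall s, a <= s <= b -> (forall t, s < t < b -> 0 < d t) ->
             p s * d1 s - p1 s * d s <= p b * d1 b - p1 b * d b).
  { intros s Hs Hds.
    apply (nondecreasing_of_is_derive (fun t => p t * d1 t - p1 t * d t)
      (fun t => p t * d2 t - p2 t * d t)); [lra| |].
    - intros t Ht; auto_derive.
      + repeat split; eexists; [apply Hp|apply Hd1|apply Hp1|apply Hd]; lra.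
      + assert (Ht' : a <= t <= b) by lra.
        rewrite_derive (Hp t Ht'); rewrite_derive (Hd1 t Ht').
        rewrite_derive (Hp1 t Ht'); rewrite_derive (Hd t Ht'); ring.
    - intros t Ht; specialize (Hineq t ltac:(lra) (Hds t Ht)); lra. }
  assert (Hall : forall t, a <= t <= b -> 0 < d t).
  { apply positive_backward; auto.
    - intros t Ht; apply (is_derive_continuous d t (d1 t)); apply Hd, Ht.
    - intros s Hs Hds.
      assert (Hq : - (d s / p s) <= - (d b / p b)).
      { apply (nondecreasing_of_is_derive (fun t => - (d t / p t))
          (fun t => (p1 t * d t - p t * d1 t) / (p t) ^ 2)); [lra| |].
        - intros t Ht; pose proof (Hpos t ltac:(lra)); auto_derive.
          + repeat split; [eexists; apply Hd; lra|eexists; apply Hp; lra|lra].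
          + assert (Ht' : a <= t <= b) by lra.
            rewrite_derive (Hp t Ht'); rewrite_derive (Hd t Ht'); field; lra.
        - intros t Ht; pose proof (Hpos t ltac:(lra)).
          apply Rdiv_le_0_compat; [|apply pow_lt; assumption].
          specialize (HN t ltac:(lra) (fun x Hx => Hds x ltac:(lra))); lra. }
      pose proof (Hpos s ltac:(lra)); pose proof (Hpos b ltac:(lra)).
      assert (0 < d b / p b) by (apply Rdiv_lt_0_compat; assumption).
      replace (d s) with (d s / p s * p s) by (field; lra).
      apply Rmult_lt_0_compat; lra. }
  split; [apply Hall; lra|].
  specialize (HN a ltac:(lra) (fun t Ht => Hall t ltac:(lra))); lra.
Qed.

(** * Integer polynomials *)

Fixpoint peval (l : list Z) (x : R) : R :=
  match l with nil => 0 | a :: l => IZR a + x * peval l x end.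

Fixpoint padd (l m : list Z) : list Z :=
  match l, m with
  | nil, _ => m
  | _, nil => l
  | a :: l, b :: m => (a + b)%Z :: padd l m
  end.

Definition pscal (c : Z) (l : list Z) : list Z := map (Z.mul c) l.

Fixpoint pmul (l m : list Z) : list Z :=
  match l with nil => nil | a :: l => padd (pscal a m) (0%Z :: pmul l m) end.

Fixpoint pder (l : list Z) : list Z :=
  match l with nil => nil | _ :: l => padd l (0%Z :: pder l) end.

Fixpoint binpow (n : nat) : list Z :=
  match n with O => [1%Z] | S n => pmul [1%Z; 1%Z] (binpow n) end.

(* coefficients of [(1 + s)^n p(s / (1 + s))], with [n] the degree of [p] *)
Fixpoint moebius (l : list Z) : list Z :=
  match l with
  | nil => nil
  | a :: l => padd (pscal a (binpow (length l))) (0%Z :: moebius l)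
  end.

(* The factor [(1 + s)^8] elevates the degree of the Bernstein form. *)
Definition nonneg01 (l : list Z) : bool :=
  (0 <=? fold_right Z.add 0 l)%Z &&
  forallb (Z.leb 0) (pmul (binpow 8) (moebius l)).

Lemma peval_padd l m x : peval (padd l m) x = peval l x + peval m x.
Proof.
  revert m; induction l as [|a l IH]; intros [|b m]; simpl; try ring.
  rewrite IH, plus_IZR; ring.
Qed.

Lemma peval_pscal c l x : peval (pscal c l) x = IZR c * peval l x.
Proof.
  unfold pscal; induction l as [|a l IH]; simpl; [ring|].
  rewrite IH, mult_IZR; ring.
Qed.

Lemma peval_pmul l m x : peval (pmul l m) x = peval l x * peval m x.
Proof.
  induction l as [|a l IH]; simpl; [ring|].
  rewrite peval_padd, peval_pscal; simpl; rewrite IH; ring.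
Qed.

Lemma peval_cons a l x : peval (a :: l) x = IZR a + x * peval l x.
Proof. reflexivity. Qed.

Ltac peval_expand H :=
  repeat first [rewrite peval_padd in H | rewrite peval_pscal in H
               | rewrite peval_pmul in H | rewrite peval_cons in H].

Lemma is_derive_peval l x : is_derive (peval l) x (peval (pder l) x).
Proof.
  induction l as [|a l IH]; simpl.
  - apply (is_derive_const 0 x).
  - rewrite peval_padd; simpl.
    auto_derive; [eexists; apply IH|].
    rewrite_derive IH; ring.
Qed.

Lemma peval_binpow n x : peval (binpow n) x = (1 + x) ^ n.
Proof.
  induction n as [|n IH]; [simpl; ring|].
  change (binpow (S n)) with (pmul [1%Z; 1%Z] (binpow n)).
  rewrite peval_pmul, IH; simpl; ring.
Qed.

(** The factor [1 + s] on the left makes up for [length l] being the degree plus one. *)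
Lemma peval_moebius l s : 0 <= s ->
  (1 + s) * peval (moebius l) s = (1 + s) ^ length l * peval l (s / (1 + s)).
Proof.
  intros Hs; induction l as [|a l IH]; [simpl; ring|].
  change (moebius (a :: l)) with
    (padd (pscal a (binpow (length l))) (0%Z :: moebius l)).
  rewrite peval_padd, peval_pscal, peval_binpow; simpl peval; simpl pow.
  rewrite Rmult_plus_distr_l, Rplus_0_l.
  replace ((1 + s) * (s * peval (moebius l) s))
    with (s * ((1 + s) * peval (moebius l) s)) by ring.
  rewrite IH; field; lra.
Qed.

Lemma peval_nonneg l x :
  forallb (Z.leb 0) l = true -> 0 <= x -> 0 <= peval l x.
Proof.
  intros H Hx; induction l as [|a l IH]; simpl in *; [lra|].
  apply andb_prop in H; destruct H as [Ha Hl].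
  apply Z.leb_le, IZR_le in Ha; specialize (IH Hl); nra.
Qed.

Lemma peval_1 l : peval l 1 = IZR (fold_right Z.add 0%Z l).
Proof.
  induction l as [|a l IH]; simpl; [reflexivity|].
  rewrite plus_IZR, IH; ring.
Qed.

Lemma peval_0 l : peval l 0 = IZR (hd 0%Z l).
Proof. destruct l; simpl; ring. Qed.

(** The substitution [s = x / (1 - x)] turns [[0, 1)] into [[0, oo)], where nonnegative coefficients
    suffice. The endpoint 1 escapes it and is tested by the sum of the coefficients. *)
Lemma nonneg01_correct l x : nonneg01 l = true -> 0 <= x <= 1 -> 0 <= peval l x.
Proof.
  intros H Hx; apply andb_prop in H; destruct H as [H1 H2].
  destruct (Req_dec x 1) as [->|Hne].
  - rewrite peval_1; apply IZR_le, Z.leb_le, H1.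
  - assert (Hs : 0 <= x / (1 - x)) by (apply Rdiv_le_0_compat; lra).
    pose proof (peval_nonneg _ _ H2 Hs) as H.
    rewrite peval_pmul, peval_binpow in H.
    pose proof (peval_moebius l _ Hs) as E.
    replace (x / (1 - x) / (1 + x / (1 - x))) with x in E by (field; lra).
    set (s := x / (1 - x)) in *.
    assert (Hp : forall n, 0 < (1 + s) ^ n) by (intros; apply pow_lt; lra).
    assert (0 <= peval (moebius l) s).
    { apply Rmult_le_reg_l with ((1 + s) ^ 8); [apply Hp|rewrite Rmult_0_r; exact H]. }
    apply Rmult_le_reg_l with ((1 + s) ^ length l); [apply Hp|].
    rewrite Rmult_0_r, <- E; apply Rmult_le_pos; lra.
Qed.

(** * Decay of the reduced profile *)

(* [u t = t Q t], for which the equation loses its first-order term. *)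
Record reduced_profile (u u1 : R -> R) : Prop := {
  rp_0 : u 0 = 0;
  rp_derive : forall t, is_derive u t (u1 t);
  rp_continuous : forall t, continuous u1 t;
  rp_ode : forall t, 0 < t -> is_derive u1 t (u t - u t ^ 3 / t ^ 2);
  rp_pos : forall t, 0 < t -> 0 < u t;
  rp_lim : vanishes (fun t => u t / t) }.

Lemma exp_merge (a b c d : R) : a + b = c -> d * exp a * exp b = d * exp c.
Proof. intros <-; rewrite exp_plus; ring. Qed.

Lemma exp_ge_quadratic (x : R) : 0 <= x -> x ^ 2 / 4 <= exp x.
Proof.
  intros Hx; replace x with (x / 2 + x / 2) at 2 by field; rewrite exp_plus.
  destruct (Req_dec x 0) as [->|Hne]; [rewrite Rdiv_0_l, exp_0; lra|].
  pose proof (exp_ineq1 (x / 2) ltac:(lra)); nra.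
Qed.

(** As [u / t -> 0], eventually [u'' >= (9/10)^2 u]. Were [u' + 9/10 u] then positive somewhere, it
    would grow exponentially, against [u <= 4/10 t]; so [u e^(9t/10)] is eventually nonincreasing.
    Convexity transfers the decay to [u']. *)
Lemma reduced_profile_decay (u u1 : R -> R) : reduced_profile u u1 ->
  exists C M, 0 < C /\ 1 <= M /\ forall t, M <= t ->
    u t <= C * exp (- (9 / 10 * t)) /\ Rabs (u1 t) <= C * exp (- (9 / 10 * t)).
Proof.
  intros [_ Hd _ Ho Hpos Hlim].
  destruct (Hlim (4 / 10)) as [M0 HM0]; [lra|].
  set (M := Rmax 1 M0).
  assert (HM1 : 1 <= M) by apply Rmax_l.
  assert (Hsmall : forall t, M <= t -> u t <= 4 / 10 * t).
  { intros t Ht.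
    assert (HMt : M0 <= t) by (eapply Rle_trans; [apply Rmax_r|exact Ht]).
    specialize (HM0 t HMt); apply Rabs_def2 in HM0; destruct HM0 as [H _].
    apply (Rmult_lt_compat_r t) in H; [|lra].
    unfold Rdiv in H; rewrite Rmult_assoc, Rinv_l in H by lra; lra. }
  assert (Hconv : forall t, M <= t -> 81 / 100 * u t <= u t - u t ^ 3 / t ^ 2).
  { intros t Ht; specialize (Hsmall t Ht); pose proof (Hpos t ltac:(lra)).
    assert (H2 : u t ^ 3 / t ^ 2 <= 16 / 100 * u t); [|nra].
    apply Rmult_le_reg_r with (t ^ 2); [nra|].
    replace (u t ^ 3 / t ^ 2 * t ^ 2) with (u t * (u t * u t)) by (field; lra).
    assert (u t * u t <= 16 / 100 * t ^ 2) by nra; nra. }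
  assert (Hneg : forall t, M <= t -> u1 t + 9 / 10 * u t <= 0).
  { intros t1 Ht1; apply Rnot_lt_le; intros Hp.
    set (c := (u1 t1 + 9 / 10 * u t1) * exp (- (9 / 10 * t1))).
    assert (Hc : 0 < c) by (apply Rmult_lt_0_compat; [lra|apply exp_pos]).
    assert (Hg : forall t, t1 <= t -> c * exp (9 / 10 * t) <= u1 t + 9 / 10 * u t).
    { intros t Ht.
      assert (HG : c <= (u1 t + 9 / 10 * u t) * exp (- (9 / 10 * t))).
      { apply (nondecreasing_of_is_derive
          (fun s => (u1 s + 9 / 10 * u s) * exp (- (9 / 10 * s)))
          (fun s => (u s - u s ^ 3 / s ^ 2 - 81 / 100 * u s) * exp (- (9 / 10 * s)))).
        - exact Ht.
        - intros s Hs; assert (Hs0 : 0 < s) by lra; auto_derive.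
          + repeat split; eexists; [apply Ho, Hs0|apply Hd].
          + rewrite_derive (Ho s Hs0); rewrite_derive (Hd s); field; lra.
        - intros s Hs; specialize (Hconv s ltac:(lra)).
          apply Rmult_le_pos; [lra|left; apply exp_pos]. }
      apply (Rmult_le_compat_r (exp (9 / 10 * t))) in HG; [|left; apply exp_pos].
      rewrite (exp_merge _ _ 0), exp_0 in HG by ring; lra. }
    (* Past [10 / c] the exponential outweighs [9/10 u] and leaves a slope of at least 1; from [t2]
       to [2 t2] this adds [t2] to [u], more than [u <= 4/10 t] allows. *)
    set (t2 := Rmax t1 (10 / c)).
    assert (H12 : t1 <= t2) by apply Rmax_l.
    assert (Hct2 : 10 <= c * t2).
    { pose proof (Rmax_r t1 (10 / c)) as H; fold t2 in H.
      apply (Rmult_le_compat_l c) in H; [|lra].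
      replace (c * (10 / c)) with 10 in H by (field; lra); exact H. }
    assert (Hslope : forall t, t2 <= t -> 1 <= u1 t).
    { intros t Ht; specialize (Hg t ltac:(lra)); specialize (Hsmall t ltac:(lra)).
      pose proof (exp_ge_quadratic (9 / 10 * t) ltac:(lra)) as He.
      assert (Hct : 10 <= c * t) by nra.
      assert (c * ((9 / 10 * t) ^ 2 / 4) <= c * exp (9 / 10 * t)) by nra.
      assert (c * ((9 / 10 * t) ^ 2 / 4) = 81 / 400 * (c * t) * t) by field.
      nra. }
    assert (H : u t2 - t2 <= u (2 * t2) - 2 * t2).
    { apply (nondecreasing_of_is_derive (fun s => u s - s) (fun s => u1 s - 1)); [lra| |].
      - intros s Hs; auto_derive; [eexists; apply Hd|].
        rewrite_derive (Hd s); ring.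
      - intros s Hs; specialize (Hslope s ltac:(lra)); lra. }
    pose proof (Hpos t2 ltac:(lra)); specialize (Hsmall (2 * t2) ltac:(lra)); lra. }
  set (C0 := u M * exp (9 / 10 * M)).
  assert (HC0 : 0 < C0) by (apply Rmult_lt_0_compat; [apply Hpos; lra|apply exp_pos]).
  assert (Hu : forall t, M <= t -> u t <= C0 * exp (- (9 / 10 * t))).
  { intros t Ht.
    assert (H : - C0 <= - (u t * exp (9 / 10 * t))).
    { apply (nondecreasing_of_is_derive (fun s => - (u s * exp (9 / 10 * s)))
        (fun s => - ((u1 s + 9 / 10 * u s) * exp (9 / 10 * s)))); [exact Ht| |].
      - intros s Hs; auto_derive; [eexists; apply Hd|].
        rewrite_derive (Hd s); field.
      - intros s Hs; specialize (Hneg s ltac:(lra)); pose proof (exp_pos (9 / 10 * s)); nra. }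
    apply Ropp_le_cancel in H.
    apply (Rmult_le_compat_r (exp (- (9 / 10 * t)))) in H; [|left; apply exp_pos].
    rewrite (exp_merge _ _ 0), exp_0 in H by ring; lra. }
  (* The extra factor and the shift by 1 come from [- u1 t <= u (t - 1) - u t], which is convexity
     on [[t - 1, t]]. *)
  exists (C0 * exp (9 / 10)), (M + 1).
  assert (He1 : 1 < exp (9 / 10)) by (rewrite <- exp_0; apply exp_increasing; lra).
  split; [nra|]; split; [lra|]; intros t Ht.
  assert (Hut : u t <= C0 * exp (9 / 10) * exp (- (9 / 10 * t))).
  { specialize (Hu t ltac:(lra)).
    pose proof (Rmult_lt_0_compat _ _ HC0 (exp_pos (- (9 / 10 * t)))); nra. }
  split; [exact Hut|].
  assert (Hmono : forall s, t - 1 <= s <= t -> u1 s <= u1 t).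
  { intros s Hs; apply (nondecreasing_of_is_derive u1 (fun s => u s - u s ^ 3 / s ^ 2)); [lra| |].
    - intros x Hx; apply Ho; lra.
    - intros x Hx; specialize (Hconv x ltac:(lra)); pose proof (Hpos x ltac:(lra)); lra. }
  assert (Hlow : (t - 1) * u1 t - u (t - 1) <= t * u1 t - u t).
  { apply (nondecreasing_of_is_derive (fun s => s * u1 t - u s) (fun s => u1 t - u1 s)); [lra| |].
    - intros s Hs; auto_derive; [eexists; apply Hd|].
      rewrite_derive (Hd s); ring.
    - intros s Hs; specialize (Hmono s ltac:(lra)); lra. }
  specialize (Hneg t ltac:(lra)); pose proof (Hpos t ltac:(lra)).
  specialize (Hu (t - 1) ltac:(lra)).
  rewrite (exp_merge _ _ (- (9 / 10 * (t - 1)))) by lra.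
  rewrite Rabs_left1; lra.
Qed.

Lemma vanishes_of_decay (f : R -> R) (C M : R) :
  (forall t, M <= t -> Rabs (f t) <= C * exp (- (9 / 10 * t))) -> vanishes f.
Proof.
  intros H; apply (vanishes_dominated f _ M H).
  apply vanishes_scal, vanishes_exp; lra.
Qed.

Lemma reduced_profile_vanishes (u u1 : R -> R) :
  reduced_profile u u1 -> vanishes u /\ vanishes u1.
Proof.
  intros H; destruct (reduced_profile_decay u u1 H) as [C [M [HC [HM HD]]]].
  split; apply (vanishes_of_decay _ C M); intros t Ht; destruct (HD t Ht) as [H1 H2].
  - rewrite Rabs_pos_eq; [exact H1|]; left; apply (rp_pos _ _ H); lra.
  - exact H2.
Qed.

Lemma vanishes_exp_mult (f : R -> R) : vanishes f -> vanishes (fun t => exp (- t) * f t).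
Proof.
  apply (vanishes_mult_bounded f (fun t => exp (- t)) 1 0); intros t Ht.
  rewrite Rabs_pos_eq by (left; apply exp_pos).
  rewrite <- exp_0; destruct Ht as [Ht| <-]; [left; apply exp_increasing; lra|].
  rewrite Ropp_0; lra.
Qed.

(* [e^{-t} (f' + f)] has derivative [e^{-t} (f'' - f)]. *)
Lemma vanishing_subsolution (f f1 f2 : R -> R) (a : R) :
  (forall t, a <= t -> is_derive f t (f1 t)) ->
  (forall t, a <= t -> is_derive f1 t (f2 t)) ->
  vanishes f -> vanishes f1 ->
  (forall t, a <= t -> f t <= f2 t) -> f1 a + f a <= 0.
Proof.
  intros Hf Hf1 Hv Hv1 Hineq.
  assert (H : exp (- a) * (f1 a + f a) <= 0).
  { apply (nondecreasing_vanishes_le_0 (fun t => exp (- t) * (f1 t + f t))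
      (fun t => exp (- t) * (f2 t - f t))).
    - intros t Ht; auto_derive.
      + repeat split; eexists; [apply Hf1|apply Hf]; lra.
      + rewrite_derive (Hf1 t Ht); rewrite_derive (Hf t Ht); ring.
    - intros t Ht; specialize (Hineq t ltac:(lra)).
      apply Rmult_le_pos; [left; apply exp_pos|lra].
    - apply vanishes_exp_mult, vanishes_plus; assumption. }
  pose proof (exp_pos (- a)); nra.
Qed.

(** The cubic term makes [- u] a subsolution. The conclusion is the sign of the derivative of
    [u e^t]. *)
Lemma reduced_profile_monotone (u u1 : R -> R) : reduced_profile u u1 ->
  forall t, 0 < t -> 0 <= u1 t + u t.
Proof.
  intros H t Ht; destruct (reduced_profile_vanishes u u1 H) as [Hv Hv1].
  destruct H as [_ Hd _ Ho Hpos _].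
  assert (Hn : - u1 t + - u t <= 0); [|lra].
  apply (vanishing_subsolution (fun s => - u s) (fun s => - u1 s)
    (fun s => - (u s - u s ^ 3 / s ^ 2))).
  - intros s Hs; apply (is_derive_opp u), Hd.
  - intros s Hs; apply (is_derive_opp u1), Ho; lra.
  - apply (vanishes_ext (fun s => (-1) * u s) _ 0); [intros; ring|].
    apply vanishes_scal, Hv.
  - apply (vanishes_ext (fun s => (-1) * u1 s) _ 0); [intros; ring|].
    apply vanishes_scal, Hv1.
  - intros s Hs; assert (0 < u s ^ 3 / s ^ 2); [|lra].
    apply Rdiv_lt_0_compat; apply pow_lt; [apply Hpos|]; lra.
Qed.

Lemma scaled_profile_nondecreasing (u u1 : R -> R) : reduced_profile u u1 ->
  forall s t, 0 < s -> s <= t -> u s * exp s <= u t * exp t.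
Proof.
  intros H s t Hs Hst.
  apply (nondecreasing_of_is_derive (fun x => u x * exp x)
    (fun x => (u1 x + u x) * exp x)); [exact Hst| |].
  - intros x Hx; auto_derive; [eexists; apply (rp_derive _ _ H)|].
    rewrite_derive (rp_derive _ _ H x); ring.
  - intros x Hx; apply Rmult_le_pos; [|left; apply exp_pos].
    apply (reduced_profile_monotone u u1 H); lra.
Qed.

(** The derivative of [e^(-t) (u' + u)] is [- e^(-t) u^3 / t^2], of size at most [C^3 e^(-3.7 t)].
    Integration from infinity bounds the derivative of [u e^t] by [C^3 e^(-1.7 t)], which is
    integrable. *)
Lemma scaled_profile_bounded (u u1 : R -> R) : reduced_profile u u1 ->
  exists B, forall t, 0 < t -> u t * exp t <= B.
Proof.
  intros H; destruct (reduced_profile_decay u u1 H) as [C [M [HC [HM HD]]]].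
  destruct (reduced_profile_vanishes u u1 H) as [Hv Hv1].
  pose proof (scaled_profile_nondecreasing u u1 H) as Hmono.
  destruct H as [_ Hd _ Ho Hpos _].
  assert (Hg : forall t, M <= t ->
            exp (- t) * (u1 t + u t) <= C ^ 3 * exp (- (37 / 10 * t))).
  { intros t Ht; apply Rminus_le.
    apply (nondecreasing_vanishes_le_0
      (fun s => exp (- s) * (u1 s + u s) - C ^ 3 * exp (- (37 / 10 * s)))
      (fun s => 37 / 10 * (C ^ 3 * exp (- (37 / 10 * s))) - exp (- s) * (u s ^ 3 / s ^ 2))).
    - intros s Hs; assert (Hs0 : 0 < s) by lra; auto_derive.
      + repeat split; eexists; [apply Ho, Hs0|apply Hd].
      + rewrite_derive (Ho s Hs0); rewrite_derive (Hd s); field; lra.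
    - intros s Hs; destruct (HD s ltac:(lra)) as [Hus _].
      pose proof (Hpos s ltac:(lra)) as Hp.
      assert (H3 : u s ^ 3 / s ^ 2 <= (C * exp (- (9 / 10 * s))) ^ 3).
      { apply Rle_trans with (u s ^ 3); [|apply pow_incr; lra].
        apply Rmult_le_reg_r with (s ^ 2); [nra|].
        unfold Rdiv; rewrite Rmult_assoc, Rinv_l, Rmult_1_r by nra.
        pose proof (pow_lt _ 3 Hp) as Hp3; assert (Hs2 : 1 <= s ^ 2) by nra.
        rewrite <- (Rmult_1_r (u s ^ 3)) at 1; apply Rmult_le_compat_l; lra. }
      assert (E : exp (- s) * (C * exp (- (9 / 10 * s))) ^ 3
                  = C ^ 3 * exp (- (37 / 10 * s))).
      { replace (exp (- (37 / 10 * s))) with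
          (exp (- s) * exp (- (9 / 10 * s)) * exp (- (9 / 10 * s)) * exp (- (9 / 10 * s)));
          [ring|].
        rewrite <- !exp_plus; f_equal; lra. }
      apply (Rmult_le_compat_l (exp (- s))) in H3; [|left; apply exp_pos].
      rewrite E in H3.
      pose proof (Rmult_lt_0_compat _ _ (pow_lt _ 3 HC) (exp_pos (- (37 / 10 * s)))); lra.
    - apply vanishes_minus; [apply vanishes_exp_mult, vanishes_plus; assumption|].
      apply vanishes_scal, vanishes_exp; lra. }
  exists (u M * exp M + C ^ 3).
  assert (HB : forall t, M <= t -> u t * exp t <= u M * exp M + C ^ 3).
  { intros t Ht.
    assert (H : - (u M * exp M) - C ^ 3 * exp (- M) <= - (u t * exp t) - C ^ 3 * exp (- t)).
    { apply (nondecreasing_of_is_derive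
        (fun s => - (u s * exp s) - C ^ 3 * exp (- s))
        (fun s => C ^ 3 * exp (- s) - exp s * (u1 s + u s))); [exact Ht| |].
      - intros s Hs; auto_derive; [eexists; apply Hd|].
        rewrite_derive (Hd s); ring.
      - intros s Hs; specialize (Hg s ltac:(lra)).
        assert (E : exp s * (u1 s + u s) = exp (2 * s) * (exp (- s) * (u1 s + u s))).
        { rewrite <- Rmult_assoc, <- exp_plus; do 2 f_equal; ring. }
        apply (Rmult_le_compat_l (exp (2 * s))) in Hg; [|left; apply exp_pos].
        replace (exp (2 * s) * (C ^ 3 * exp (- (37 / 10 * s))))
          with (C ^ 3 * exp (- (17 / 10 * s))) in Hg.
        2:{ replace (- (17 / 10 * s)) with (2 * s + - (37 / 10 * s)) by field.
            rewrite exp_plus; ring. }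
        assert (exp (- (17 / 10 * s)) < exp (- s)) by (apply exp_increasing; lra).
        pose proof (pow_lt _ 3 HC); nra. }
    assert (exp (- M) < 1) by (rewrite <- exp_0; apply exp_increasing; lra).
    pose proof (pow_lt _ 3 HC); pose proof (exp_pos (- t)); nra. }
  intros t Ht; destruct (Rle_dec M t) as [HMt|HMt]; [auto|].
  apply Rle_trans with (u M * exp M); [apply Hmono; lra|].
  pose proof (pow_lt _ 3 HC); lra.
Qed.

(** Being nondecreasing and bounded, [u e^t] tends to its supremum, so one constant [A] serves as
    bound and as limit. *)
Lemma scaled_profile_limit (u u1 : R -> R) : reduced_profile u u1 ->
  exists A, 0 < A /\ (forall t, 0 < t -> u t <= A * exp (- t)) /\
    vanishes (fun t => u t * exp t - A).
Proof.
  intros H; destruct (scaled_profile_bounded u u1 H) as [B HB].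
  destruct (completeness (fun y => exists t, 0 < t /\ y = u t * exp t)) as [A [HA1 HA2]].
  - exists B; intros y [t [Ht ->]]; auto.
  - exists (u 1 * exp 1), 1; split; [lra|reflexivity].
  - assert (Hle : forall t, 0 < t -> u t * exp t <= A) by (intros t Ht; apply HA1; eauto).
    exists A; split; [|split].
    + pose proof (rp_pos _ _ H 1 ltac:(lra)); pose proof (exp_pos 1).
      specialize (Hle 1 ltac:(lra)); nra.
    + intros t Ht; specialize (Hle t Ht).
      apply (Rmult_le_compat_r (exp (- t))) in Hle; [|left; apply exp_pos].
      rewrite (exp_merge _ _ 0), exp_0 in Hle by ring; lra.
    + intros eps He.
      destruct (classic (exists s, 0 < s /\ A - eps < u s * exp s)) as [[s [Hs Hs2]]|Hno].
      * exists s; intros t Ht.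
        pose proof (scaled_profile_nondecreasing u u1 H s t Hs Ht).
        specialize (Hle t ltac:(lra)); rewrite Rabs_left1; lra.
      * exfalso; assert (HA : A <= A - eps); [|lra].
        apply HA2; intros y [t [Ht ->]]; apply Rnot_lt_le; intros Hlt; eauto.
Qed.

(** * The comparison function near infinity *)

(** Leading term [a e^(-t)] with its first cubic correction, asymptotically
    [- a^3 e^(-3t) / (8 t^2)]. The next order would give [12 t] in the denominator; the smaller
    [11 t] yields an inequality valid for all [t > 0]. *)
Definition outer (a t : R) : R :=
  a * exp (- t) - a ^ 3 * exp (- (3 * t)) / (8 * t ^ 2 + 11 * t).

Definition outer1 (a t : R) : R :=
  - a * exp (- t) + a ^ 3 * exp (- (3 * t)) *
    (3 / (8 * t ^ 2 + 11 * t) + (16 * t + 11) / (8 * t ^ 2 + 11 * t) ^ 2).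

Definition outer2 (a t : R) : R :=
  a * exp (- t) - a ^ 3 * exp (- (3 * t)) *
    (9 / (8 * t ^ 2 + 11 * t) + (96 * t + 50) / (8 * t ^ 2 + 11 * t) ^ 2
     + 2 * (16 * t + 11) ^ 2 / (8 * t ^ 2 + 11 * t) ^ 3).

Lemma is_derive_outer a t : 0 < t -> is_derive (outer a) t (outer1 a t).
Proof.
  intros Ht; assert (0 < 8 * t ^ 2 + 11 * t) by nra.
  unfold outer, outer1; auto_derive; [lra|]; field; lra.
Qed.

Lemma is_derive_outer1 a t : 0 < t -> is_derive (outer1 a) t (outer2 a t).
Proof.
  intros Ht; assert (0 < 8 * t ^ 2 + 11 * t) by nra.
  unfold outer1, outer2; auto_derive; [repeat split; nra|]; field; nra.
Qed.

(** The cube is that of [a e^(-t)], which is later an upper bound for [u] in one comparison and for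
    [outer a] in the other. *)
Lemma outer_supersolution a t : 0 < a -> 0 < t ->
  outer2 a t - outer a t <= - (a * exp (- t)) ^ 3 / t ^ 2.
Proof.
  intros Ha Ht; unfold outer2, outer.
  replace ((a * exp (- t)) ^ 3) with (a ^ 3 * exp (- (3 * t))).
  2:{ replace (- (3 * t)) with (- t + - t + - t) by ring; rewrite !exp_plus; ring. }
  assert (HK : 0 < a ^ 3 * exp (- (3 * t)))
    by (apply Rmult_lt_0_compat; [apply pow_lt, Ha|apply exp_pos]).
  set (K := a ^ 3 * exp (- (3 * t))) in *; set (P := 8 * t ^ 2 + 11 * t).
  assert (HP : 0 < P) by (unfold P; nra).
  assert (H : / t ^ 2 <= 8 / P + (96 * t + 50) / P ^ 2 + 2 * (16 * t + 11) ^ 2 / P ^ 3).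
  { apply Rminus_le_0.
    replace (8 / P + (96 * t + 50) / P ^ 2 + 2 * (16 * t + 11) ^ 2 / P ^ 3 - / t ^ 2)
      with ((64 * t ^ 3 + 32 * t ^ 2 - 77 * t + 242) / P ^ 3).
    2:{ unfold P; field; unfold P in HP; split; [lra|]; nra. }
    apply Rdiv_le_0_compat; [nra|apply pow_lt, HP]. }
  apply (Rmult_le_compat_l K) in H; [|lra].
  replace (- K / t ^ 2) with (- (K * / t ^ 2)) by (field; lra).
  apply Ropp_le_contravar in H; eapply Rle_trans; [|exact H].
  right; field; lra.
Qed.

Lemma outer_denominator_inv (t : R) : 1 <= t -> 0 < / (8 * t ^ 2 + 11 * t) <= 1.
Proof.
  intros Ht; assert (1 <= 8 * t ^ 2 + 11 * t) by nra.
  split; [apply Rinv_0_lt_compat; lra|].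
  rewrite <- Rinv_1; apply Rinv_le_contravar; lra.
Qed.

Lemma outer_vanishes a : vanishes (outer a) /\ vanishes (outer1 a) /\
  vanishes (fun t => outer a t * exp t - a).
Proof.
  assert (V1 : vanishes (fun t => exp (- t))).
  { apply (vanishes_ext (fun t => exp (- (1 * t))) _ 0);
      [intros; f_equal; ring|apply vanishes_exp; lra]. }
  assert (V3 : vanishes (fun t => exp (- (3 * t)))) by (apply vanishes_exp; lra).
  assert (V2 : vanishes (fun t => exp (- (2 * t)))) by (apply vanishes_exp; lra).
  assert (B : forall t, 1 <= t -> Rabs (/ (8 * t ^ 2 + 11 * t)) <= 1).
  { intros t Ht; pose proof (outer_denominator_inv t Ht); rewrite Rabs_pos_eq; lra. }
  split; [|split].
  - apply (vanishes_ext (fun t => a * exp (- t) -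
      a ^ 3 * (/ (8 * t ^ 2 + 11 * t) * exp (- (3 * t)))) _ 1).
    + intros t Ht; unfold outer; field; nra.
    + apply vanishes_minus; apply vanishes_scal; [exact V1|].
      apply (vanishes_mult_bounded _ _ 1 1 B V3).
  - apply (vanishes_ext (fun t => (- a) * exp (- t) + a ^ 3 *
      ((3 / (8 * t ^ 2 + 11 * t) + (16 * t + 11) / (8 * t ^ 2 + 11 * t) ^ 2)
        * exp (- (3 * t)))) _ 1).
    + intros t Ht; unfold outer1; field; nra.
    + apply vanishes_plus; apply vanishes_scal; [exact V1|].
      (* Each of the two fractions is at most 3 for [t >= 1]. *)
      apply (vanishes_mult_bounded _ _ 6 1); [|exact V3].
      intros t Ht; pose proof (outer_denominator_inv t Ht) as Hi.
      set (P := 8 * t ^ 2 + 11 * t) in *.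
      assert (HP : 16 * t + 11 <= 3 * P) by (unfold P; nra).
      assert (HP0 : 0 < P) by (unfold P; nra).
      assert (H1 : 0 <= (16 * t + 11) / P ^ 2 <= 3 * / P).
      { split; [apply Rdiv_le_0_compat; [lra|apply pow_lt, HP0]|].
        apply Rmult_le_reg_r with (P ^ 2); [apply pow_lt, HP0|].
        replace ((16 * t + 11) / P ^ 2 * P ^ 2) with (16 * t + 11) by (field; lra).
        replace (3 * / P * P ^ 2) with (3 * P) by (field; lra); exact HP. }
      rewrite Rabs_pos_eq; unfold Rdiv at 1; lra.
  - apply (vanishes_ext (fun t => - a ^ 3 * (/ (8 * t ^ 2 + 11 * t) * exp (- (2 * t)))) _ 1).
    + intros t Ht; unfold outer.
      assert (E1 : exp (- t) * exp t = 1)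
        by (rewrite <- exp_plus, Rplus_opp_l; apply exp_0).
      assert (E2 : exp (- (3 * t)) * exp t = exp (- (2 * t)))
        by (rewrite <- exp_plus; f_equal; ring).
      replace ((a * exp (- t) - a ^ 3 * exp (- (3 * t)) / (8 * t ^ 2 + 11 * t)) * exp t - a)
        with (a * (exp (- t) * exp t) -
              a ^ 3 * (exp (- (3 * t)) * exp t) / (8 * t ^ 2 + 11 * t) - a)
        by (field; nra).
      rewrite E1, E2; field; nra.
    + apply vanishes_scal; apply (vanishes_mult_bounded _ _ 1 1 B V2).
Qed.

(** Since [u <= A e^(-t)], the difference [d = u - outer A] satisfies [d'' >= d]. Hence
    [d' + d <= 0], and [d e^t] decreases to its limit 0. *)
Lemma profile_ge_outer (u u1 : R -> R) (A : R) : reduced_profile u u1 -> 0 < A ->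
  (forall t, 0 < t -> u t <= A * exp (- t)) ->
  vanishes (fun t => u t * exp t - A) -> forall t, 0 < t -> outer A t <= u t.
Proof.
  intros H HA Hle Hlim t Ht.
  destruct (reduced_profile_vanishes u u1 H) as [Hv Hv1].
  destruct (outer_vanishes A) as [Tv [Tv1 Tlim]].
  destruct H as [_ Hd _ Ho Hpos _].
  assert (Hneg : forall s, 0 < s -> (u1 s - outer1 A s) + (u s - outer A s) <= 0).
  { intros s Hs.
    apply (vanishing_subsolution (fun x => u x - outer A x) (fun x => u1 x - outer1 A x)
      (fun x => u x - u x ^ 3 / x ^ 2 - outer2 A x)).
    - intros x Hx; apply (is_derive_minus u); [apply Hd|apply is_derive_outer; lra].
    - intros x Hx; apply (is_derive_minus u1); [apply Ho|apply is_derive_outer1]; lra.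
    - apply vanishes_minus; assumption.
    - apply vanishes_minus; assumption.
    - intros x Hx; pose proof (outer_supersolution A x HA ltac:(lra)) as Hs2.
      assert (u x ^ 3 / x ^ 2 <= (A * exp (- x)) ^ 3 / x ^ 2).
      { apply Rmult_le_compat_r; [left; apply Rinv_0_lt_compat, pow_lt; lra|].
        apply pow_incr; split; [left; apply Hpos|apply Hle]; lra. }
      unfold Rdiv in *; rewrite Ropp_mult_distr_l_reverse in Hs2; lra. }
  assert (H : (outer A t - u t) * exp t <= 0).
  { apply (nondecreasing_vanishes_le_0 (fun s => (outer A s - u s) * exp s)
      (fun s => - ((u1 s - outer1 A s) + (u s - outer A s)) * exp s)).
    - intros s Hs; assert (Hs0 : 0 < s) by lra; auto_derive.
      + repeat split; eexists; [apply is_derive_outer, Hs0|apply Hd].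
      + rewrite_derive (is_derive_outer A s Hs0); rewrite_derive (Hd s); ring.
    - intros s Hs; specialize (Hneg s ltac:(lra)).
      apply Rmult_le_pos; [lra|left; apply exp_pos].
    - apply (vanishes_ext (fun s => (outer A s * exp s - A) - (u s * exp s - A)) _ 0);
        [intros; ring|apply vanishes_minus; assumption]. }
  pose proof (exp_pos t); nra.
Qed.

(** * From the ground state to its reduced profile *)

Lemma ground_state_is_derive (Q : R -> R) : is_ground_state_profile Q ->
  forall t, is_derive Q t (Derive Q t).
Proof. intros [_ [H _]] t; apply Derive_correct, H. Qed.

Lemma ground_state_is_derive2 (Q : R -> R) : is_ground_state_profile Q ->
  forall t, 0 < t -> is_derive (Derive Q) t (Q t - Q t ^ 3 - 2 / t * Derive Q t).
Proof.
  intros [_ [_ [H2 [_ [Ho _]]]]] t Ht.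
  replace (Q t - Q t ^ 3 - 2 / t * Derive Q t) with (Derive (Derive Q) t).
  - apply Derive_correct, H2.
  - specialize (Ho t Ht); change (Derive_n Q 2 t) with (Derive (Derive Q) t) in Ho; lra.
Qed.

(** Differentiating the evenness relation at 0 gives [Q'(0) = - Q'(0)]. *)
Lemma ground_state_derive_0 (Q : R -> R) : is_ground_state_profile Q -> Derive Q 0 = 0.
Proof.
  intros HQ; pose proof (ground_state_is_derive Q HQ 0) as H.
  destruct HQ as [Heven _].
  assert (H' : is_derive Q 0 (- Derive Q 0)).
  { apply (is_derive_ext (fun t => Q (- t))); [exact Heven|].
    rewrite <- Ropp_0 in H at 1.
    auto_derive; [eexists; exact H|]. rewrite_derive H; ring. }
  pose proof (is_derive_unique _ _ _ H'); lra.
Qed.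

Lemma ground_state_vanishes (Q : R -> R) : is_ground_state_profile Q -> vanishes Q.
Proof.
  intros [_ [_ [_ [_ [_ Hl]]]]] eps He.
  apply is_lim_spec in Hl; destruct (Hl (mkposreal eps He)) as [M HM].
  exists (M + 1); intros t Ht; specialize (HM t ltac:(lra)); simpl in HM.
  rewrite Rminus_0_r in HM; exact HM.
Qed.

Lemma ground_state_reduced (Q : R -> R) : is_ground_state_profile Q ->
  reduced_profile (fun t => t * Q t) (fun t => Q t + t * Derive Q t).
Proof.
  intros HQ; pose proof (ground_state_is_derive Q HQ) as Hd.
  pose proof (ground_state_is_derive2 Q HQ) as Hd2.
  split.
  - ring.
  - intros t; auto_derive; [eexists; apply Hd|]; rewrite_derive (Hd t); ring.
  - intros t; destruct HQ as [_ [_ [H2 _]]].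
    eapply (is_derive_continuous _ t); auto_derive;
      [repeat split; [eexists; apply Hd|apply H2]|reflexivity].
  - intros t Ht; auto_derive.
    + repeat split; eexists; [apply Hd|apply Hd2, Ht].
    + rewrite_derive (Hd t); rewrite_derive (Hd2 t Ht); field; lra.
  - intros t Ht; destruct HQ as [_ [_ [_ [Hp _]]]].
    apply Rmult_lt_0_compat; [exact Ht|apply Hp; lra].
  - apply (vanishes_ext Q _ 1); [intros; field; lra|].
    apply ground_state_vanishes, HQ.
Qed.

Lemma ground_state_derive_vanishes (Q : R -> R) :
  is_ground_state_profile Q -> vanishes (Derive Q).
Proof.
  intros HQ; pose proof (ground_state_vanishes Q HQ) as Hv.
  destruct (reduced_profile_vanishes _ _ (ground_state_reduced Q HQ)) as [_ Hv1].
  apply (vanishes_ext (fun t => / t * (Q t + t * Derive Q t - Q t)) _ 1);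
    [intros; field; lra|].
  apply (vanishes_mult_bounded _ _ 1 1); [|apply vanishes_minus; assumption].
  intros t Ht; rewrite Rabs_pos_eq by (left; apply Rinv_0_lt_compat; lra).
  rewrite <- Rinv_1; apply Rinv_le_contravar; lra.
Qed.

(** * Energy and lower bounds for the ground state *)

(** The term [(2/t) Q'] dissipates this energy, which tends to 0 at infinity. The proof works with
    its negative [E], which is nondecreasing. *)
Lemma ground_state_energy (Q : R -> R) : is_ground_state_profile Q ->
  forall t, 0 <= t -> 0 <= (Derive Q t) ^ 2 / 2 + Q t ^ 4 / 4 - Q t ^ 2 / 2.
Proof.
  intros HQ.
  set (E := fun t => - ((Derive Q t) ^ 2 / 2 + Q t ^ 4 / 4 - Q t ^ 2 / 2)).
  pose proof (ground_state_is_derive Q HQ) as Hd.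
  pose proof (ground_state_is_derive2 Q HQ) as Hd2.
  assert (HE : forall t, 0 < t -> is_derive E t (2 / t * (Derive Q t) ^ 2)).
  { intros t Ht; unfold E; auto_derive.
    - repeat split; eexists; [apply Hd2, Ht|apply Hd|apply Hd].
    - rewrite_derive (Hd2 t Ht); rewrite_derive (Hd t); field; lra. }
  assert (Hp : forall t, 0 < t -> 0 <= 2 / t * (Derive Q t) ^ 2).
  { intros t Ht; apply Rmult_le_pos; [apply Rdiv_le_0_compat; lra|apply pow2_ge_0]. }
  assert (Hv : vanishes E).
  { pose proof (ground_state_vanishes Q HQ) as HvQ.
    pose proof (ground_state_derive_vanishes Q HQ) as HvD.
    assert (Hb : exists M, forall t, M <= t -> Rabs (Q t) <= 1 /\ Rabs (Derive Q t) <= 1).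
    { destruct (HvQ 1) as [M1 H1]; [lra|]; destruct (HvD 1) as [M2 H2]; [lra|].
      exists (Rmax M1 M2); intros t Ht.
      pose proof (Rmax_l M1 M2); pose proof (Rmax_r M1 M2).
      split; left; [apply H1|apply H2]; lra. }
    destruct Hb as [M Hb].
    apply (vanishes_ext (fun t => (- Derive Q t / 2) * Derive Q t
      + (- (Q t) ^ 3 / 4 + Q t / 2) * Q t) _ 0); [intros; unfold E; field|].
    apply vanishes_plus; eapply (vanishes_mult_bounded _ _ 1 M); try assumption;
      intros t Ht; destruct (Hb t Ht) as [B1 B2];
      apply Rabs_le_between in B1; apply Rabs_le_between in B2; apply Rabs_le; nra. }
  assert (Hpos : forall t, 0 < t -> E t <= 0).
  { intros t Ht; apply (nondecreasing_vanishes_le_0 E (fun t => 2 / t * (Derive Q t) ^ 2));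
      [intros s Hs; apply HE|intros s Hs; apply Hp|exact Hv]; lra. }
  intros t Ht; cut (E t <= 0); [unfold E; lra|].
  destruct Ht as [Ht| <-]; [apply Hpos, Ht|].
  (* At 0 the formula for the derivative of [E] breaks down; continuity at 0 suffices to compare
     with [E 1]. *)
  apply Rle_trans with (E 1); [|apply Hpos; lra].
  apply (nondecreasing_of_derive E (fun t => 2 / t * (Derive Q t) ^ 2)); [lra| | |].
  - intros t _; destruct HQ as [_ [_ [H2 _]]].
    eapply (is_derive_continuous E t); unfold E; auto_derive;
      [repeat split; [apply H2|eexists; apply Hd|eexists; apply Hd]|reflexivity].
  - intros t Ht; apply HE; lra.
  - intros t Ht; apply Hp; lra.
Qed.

(* A critical point has nonnegative energy only above [sqrt 2 > 7/5]. *)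
Lemma ground_state_lower_bound (Q : R -> R) (c T : R) : is_ground_state_profile Q ->
  0 < T -> c <= 7 / 5 -> c <= Q T -> forall t, 0 <= t <= T -> c <= Q t.
Proof.
  intros HQ HT Hc HcT t Ht.
  pose proof (ground_state_is_derive Q HQ) as Hd.
  (* The minimum over [[0, T]] lies at [T] or at a critical point, 0 being one by evenness. *)
  destruct (continuity_ab_min Q 0 T) as [m [Hmin Hm]]; [lra| |].
  { intros x _; apply continuity_pt_filterlim.
    apply (is_derive_continuous Q x _ (Hd x)). }
  apply Rle_trans with (Q m); [|apply Hmin, Ht].
  destruct (Req_dec m T) as [->|HmT]; [exact HcT|].
  assert (Hcrit : Derive Q m = 0).
  { destruct (Req_dec m 0) as [->|Hm0]; [apply ground_state_derive_0, HQ|].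
    assert (pr : derivable_pt Q m) by (apply ex_derive_Reals_0; eexists; apply Hd).
    rewrite <- (Derive_Reals Q m pr); apply (deriv_minimum Q 0 T m pr); try lra.
    intros x H0 H1; apply Hmin; lra. }
  pose proof (ground_state_energy Q HQ m ltac:(lra)) as HE; rewrite Hcrit in HE.
  destruct HQ as [_ [_ [_ [Hp _]]]]; specialize (Hp m ltac:(lra)).
  assert (0 <= Q m ^ 2 * (Q m ^ 2 - 2)) by (replace (Q m ^ 2 * (Q m ^ 2 - 2))
    with (4 * (0 ^ 2 / 2 + Q m ^ 4 / 4 - Q m ^ 2 / 2)) by field; lra).
  assert (2 <= Q m ^ 2) by (pose proof (pow_lt _ 2 Hp); nra).
  nra.
Qed.

(** * Upper bounds from convexity of the cube *)

Lemma cube_tangent (q s : R) : 0 <= q -> 0 <= s -> 3 * s ^ 2 * q - 2 * s ^ 3 <= q ^ 3.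
Proof.
  intros Hq Hs; assert (0 <= (q - s) ^ 2 * (q + 2 * s)); [|lra].
  apply Rmult_le_pos; [apply pow2_ge_0|lra].
Qed.

(* Jensen's inequality against the first radial Dirichlet eigenfunction
   [sin (PI t / T) / t] of the ball of radius [T]. *)
Lemma reduced_profile_eigenfunction_bound (u u1 : R -> R) (T : R) :
  reduced_profile u u1 -> 0 < T -> 27 * PI ^ 4 * u T ^ 2 <= 4 * (T ^ 2 + PI ^ 2) ^ 3.
Proof.
  intros [H0 Hd Hc Ho Hpos _] HT; pose proof PI_RGT_0 as HPI.
  set (w := PI / T); assert (Hw : 0 < w) by (apply Rdiv_lt_0_compat; lra).
  assert (HwT : w * T = PI) by (unfold w; field; lra).
  (* Tangent point with [3 S^2 = 1 + w^2], for which the terms linear in [u] cancel. *)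
  set (S := sqrt ((1 + w ^ 2) / 3)).
  assert (HS2 : S ^ 2 = (1 + w ^ 2) / 3) by (apply pow2_sqrt; nra).
  assert (HS : 0 <= S) by apply sqrt_pos.
  (* Wronskian of [sin (w t)] and [u], plus a primitive of [2 S^3 t sin (w t)]. *)
  set (f := fun t => w * cos (w * t) * u t - sin (w * t) * u1 t
     + 2 * S ^ 3 * (sin (w * t) / w ^ 2 - t * cos (w * t) / w)).
  assert (Hf : f 0 <= f T).
  { apply (nondecreasing_of_derive f (fun t => sin (w * t) *
      (u t ^ 3 / t ^ 2 - (1 + w ^ 2) * u t + 2 * S ^ 3 * t))); [lra| | |].
    - intros t _; unfold f.
      apply (continuous_plus (fun t => w * cos (w * t) * u t - sin (w * t) * u1 t)).
      + apply (continuous_minus (fun t => w * cos (w * t) * u t)).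
        * eapply (is_derive_continuous _ t); auto_derive; [eexists; apply Hd|reflexivity].
        * apply (continuous_mult (fun t => sin (w * t))); [|apply Hc].
          eapply (is_derive_continuous _ t); auto_derive; [exact I|reflexivity].
      + eapply (is_derive_continuous _ t); auto_derive; [split; lra|reflexivity].
    - intros t Ht; assert (Ht0 : 0 < t) by lra; unfold f; auto_derive.
      + repeat split; try lra; eexists; [apply Hd|apply Ho, Ht0].
      + rewrite_derive (Hd t); rewrite_derive (Ho t Ht0); field; lra.
    - intros t Ht; apply Rmult_le_pos.
      + apply sin_ge_0; [nra|]; rewrite <- HwT; nra.
      + pose proof (cube_tangent (u t / t) S
          ltac:(left; apply Rdiv_lt_0_compat; [apply Hpos|]; lra) HS) as Hct.
        rewrite HS2 in Hct; apply (Rmult_le_compat_l t) in Hct; [|lra].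
        replace (t * (u t / t) ^ 3) with (u t ^ 3 / t ^ 2) in Hct by (field; lra).
        replace (t * (3 * ((1 + w ^ 2) / 3) * (u t / t) - 2 * S ^ 3))
          with ((1 + w ^ 2) * u t - 2 * S ^ 3 * t) in Hct by (field; lra).
        lra. }
  unfold f in Hf; rewrite HwT, Rmult_0_r, H0, sin_0, cos_0, sin_PI, cos_PI in Hf.
  assert (HuT : w ^ 2 * u T <= 2 * S ^ 3 * T).
  { apply Rmult_le_reg_r with (/ w); [apply Rinv_0_lt_compat, Hw|].
    replace (w ^ 2 * u T * / w) with (w * u T) by (field; lra).
    replace (2 * S ^ 3 * T * / w) with (2 * S ^ 3 * T / w) by reflexivity.
    unfold Rdiv in *; lra. }
  assert (Hsq : (w ^ 2 * u T) ^ 2 <= (2 * S ^ 3 * T) ^ 2).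
  { apply pow_incr; split; [|exact HuT].
    apply Rmult_le_pos; [apply pow2_ge_0|left; apply Hpos, HT]. }
  replace ((2 * S ^ 3 * T) ^ 2) with (4 * (S ^ 2) ^ 3 * T ^ 2) in Hsq by ring.
  rewrite HS2 in Hsq; unfold w in Hsq.
  apply (Rmult_le_compat_r (27 * T ^ 4)) in Hsq; [|pose proof (pow_lt _ 4 HT); lra].
  replace ((((PI / T) ^ 2 * u T) ^ 2) * (27 * T ^ 4)) with (27 * PI ^ 4 * u T ^ 2)
    in Hsq by (field; lra).
  replace (4 * ((1 + (PI / T) ^ 2) / 3) ^ 3 * T ^ 2 * (27 * T ^ 4))
    with (4 * (T ^ 2 + PI ^ 2) ^ 3) in Hsq by (field; lra).
  exact Hsq.
Qed.

Lemma PI_bounds : 314 / 100 <= PI <= 31435 / 10000.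
Proof.
  pose proof (PI_2_3_7_ineq 1) as H; unfold tg_alt, PI_2_3_7_tg, Ratan_seq in H.
  simpl in H; lra.
Qed.

(** Polynomial form of the eigenfunction bound, fit for [lra] and for the integer polynomial
    tests. *)
Lemma reduced_profile_upper_bound (u u1 : R -> R) (T : R) :
  reduced_profile u u1 -> 0 < T ->
  u T <= 121 / 100 + 184 / 1000 * T ^ 2 + 47 / 10000 * T ^ 4.
Proof.
  intros H HT.
  pose proof (reduced_profile_eigenfunction_bound u u1 T H HT) as Hb.
  pose proof (rp_pos _ _ H T HT) as Hu; pose proof PI_bounds as HP.
  assert (HPI : 0 < PI) by lra.
  set (x := T ^ 2) in *; assert (Hx : 0 <= x) by apply pow2_ge_0.
  replace (T ^ 4) with (x ^ 2) by (unfold x; ring).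
  (* [(1 + y)^(3/2) <= 1 + 3 y / 2 + 3 y^2 / 8] with [y = x / PI^2] *)
  set (w := PI + 3 / 2 * x / PI + 3 / 8 * x ^ 2 / PI ^ 3).
  assert (Hw0 : 0 <= 3 / 2 * x / PI) by (apply Rdiv_le_0_compat; lra).
  assert (Hw1 : 0 <= 3 / 8 * x ^ 2 / PI ^ 3).
  { apply Rdiv_le_0_compat; [pose proof (pow2_ge_0 x); lra|apply pow_lt, HPI]. }
  assert (Hw : 4 * (x + PI ^ 2) ^ 3 <= 4 * (PI ^ 4 * w ^ 2)).
  { replace (PI ^ 4 * w ^ 2) with ((x + PI ^ 2) ^ 3 + (x ^ 3 / 8 + 9 / 64 * (x ^ 4 / PI ^ 2)))
      by (unfold w; field; lra).
    assert (0 <= x ^ 3) by (apply pow_le, Hx).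
    assert (0 <= x ^ 4 / PI ^ 2)
      by (apply Rdiv_le_0_compat; [apply pow_le, Hx|apply pow_lt, HPI]).
    lra. }
  assert (Hu2 : 27 * u T ^ 2 <= 4 * w ^ 2).
  { apply Rmult_le_reg_l with (PI ^ 4); [apply pow_lt, HPI|]; lra. }
  (* The constant is slightly above [2 / sqrt 27]. *)
  assert (Hub : u T <= 38491 / 100000 * w).
  { apply Rnot_lt_le; intros Hlt; assert (0 < w) by (unfold w; lra); nra. }
  assert (Hi : / PI <= 100 / 314).
  { replace (100 / 314) with (/ (314 / 100)) by field; apply Rinv_le_contravar; lra. }
  assert (Hi3 : (/ PI) ^ 3 <= (100 / 314) ^ 3).
  { apply pow_incr; split; [left; apply Rinv_0_lt_compat|]; lra. }
  assert (E0 : 3 / 2 * x / PI <= 3 / 2 * (100 / 314) * x) by (unfold Rdiv at 2; nra).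
  assert (E1 : 3 / 8 * x ^ 2 / PI ^ 3 <= 3 / 8 * (100 / 314) ^ 3 * x ^ 2).
  { replace (3 / 8 * x ^ 2 / PI ^ 3) with (3 / 8 * ((/ PI) ^ 3 * x ^ 2)) by (field; lra).
    pose proof (pow2_ge_0 x).
    assert ((/ PI) ^ 3 * x ^ 2 <= (100 / 314) ^ 3 * x ^ 2)
      by (apply Rmult_le_compat_r; assumption).
    lra. }
  unfold w in Hub; pose proof (pow2_ge_0 x); lra.
Qed.

(** * Values of the exponential *)

(** Integrating a lower bound of [e^(-x)] gives an upper one; alternating with the mirror lemma
    climbs the Taylor polynomials. *)
Lemma exp_neg_upper_step (p q : R -> R) :
  (forall x, is_derive p x (- q x)) -> p 0 = 1 ->
  (forall x, 0 <= x -> q x <= exp (- x)) -> forall x, 0 <= x -> exp (- x) <= p x.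
Proof.
  intros Hp H0 Hq x Hx.
  assert (H : p 0 - exp (- 0) <= p x - exp (- x)).
  { apply (nondecreasing_of_is_derive (fun y => p y - exp (- y))
      (fun y => exp (- y) - q y)); [exact Hx| |].
    - intros y Hy; auto_derive; [eexists; apply Hp|].
      rewrite_derive (Hp y); ring.
    - intros y Hy; specialize (Hq y ltac:(lra)); lra. }
  rewrite Ropp_0, exp_0, H0 in H; lra.
Qed.

Lemma exp_neg_lower_step (p q : R -> R) :
  (forall x, is_derive p x (- q x)) -> p 0 = 1 ->
  (forall x, 0 <= x -> exp (- x) <= q x) -> forall x, 0 <= x -> p x <= exp (- x).
Proof.
  intros Hp H0 Hq x Hx.
  assert (H : exp (- 0) - p 0 <= exp (- x) - p x).
  { apply (nondecreasing_of_is_derive (fun y => exp (- y) - p y)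
      (fun y => q y - exp (- y))); [exact Hx| |].
    - intros y Hy; auto_derive; [eexists; apply Hp|].
      rewrite_derive (Hp y); ring.
    - intros y Hy; specialize (Hq y ltac:(lra)); lra. }
  rewrite Ropp_0, exp_0, H0 in H; lra.
Qed.

Lemma exp_neg_le_2 x : 0 <= x -> exp (- x) <= 1 - x + x ^ 2 / 2.
Proof.
  apply (exp_neg_upper_step (fun x => 1 - x + x ^ 2 / 2) (fun x => 1 - x)).
  - intros y; auto_derive; [exact I|field].
  - field.
  - intros y _; pose proof (exp_ineq1_le (- y)); lra.
Qed.

Lemma exp_neg_ge_5 x : 0 <= x ->
  1 - x + x ^ 2 / 2 - x ^ 3 / 6 + x ^ 4 / 24 - x ^ 5 / 120 <= exp (- x).
Proof.
  apply (exp_neg_lower_step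
    (fun x => 1 - x + x ^ 2 / 2 - x ^ 3 / 6 + x ^ 4 / 24 - x ^ 5 / 120)
    (fun x => 1 - x + x ^ 2 / 2 - x ^ 3 / 6 + x ^ 4 / 24)).
  { intros y; auto_derive; [exact I|field]. } { field. }
  apply (exp_neg_upper_step _ (fun x => 1 - x + x ^ 2 / 2 - x ^ 3 / 6)).
  { intros y; auto_derive; [exact I|field]. } { field. }
  apply (exp_neg_lower_step _ (fun x => 1 - x + x ^ 2 / 2)).
  { intros y; auto_derive; [exact I|field]. } { field. }
  exact exp_neg_le_2.
Qed.

Lemma exp_neg_le_6 x : 0 <= x ->
  exp (- x) <= 1 - x + x ^ 2 / 2 - x ^ 3 / 6 + x ^ 4 / 24 - x ^ 5 / 120 + x ^ 6 / 720.
Proof.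
  apply (exp_neg_upper_step
    (fun x => 1 - x + x ^ 2 / 2 - x ^ 3 / 6 + x ^ 4 / 24 - x ^ 5 / 120 + x ^ 6 / 720)
    (fun x => 1 - x + x ^ 2 / 2 - x ^ 3 / 6 + x ^ 4 / 24 - x ^ 5 / 120)).
  { intros y; auto_derive; [exact I|field]. } { field. }
  exact exp_neg_ge_5.
Qed.

Lemma square_between (a b x : R) : 0 <= a -> a <= x <= b -> a * a <= x * x <= b * b.
Proof. intros; split; apply Rmult_le_compat; lra. Qed.

Lemma exp_neg_1_bounds : 36787942 / 100000000 <= exp (- (1)) <= 36787945 / 100000000.
Proof.
  (* The Taylor bounds are sharp at [1/8], and three squarings lead to 1. *)
  pose proof (exp_neg_ge_5 (1 / 8) ltac:(lra)) as Hl.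
  pose proof (exp_neg_le_6 (1 / 8) ltac:(lra)) as Hu.
  assert (H : 88249689737 / 100000000000 <= exp (- (1 / 8)) <= 88249690268 / 100000000000)
    by lra.
  apply square_between in H; [|lra]; rewrite <- exp_plus in H.
  apply square_between in H; [|lra]; rewrite <- exp_plus in H.
  apply square_between in H; [|lra]; rewrite <- exp_plus in H.
  replace (- (1)) with (- (1 / 8) + - (1 / 8) + (- (1 / 8) + - (1 / 8)) +
    (- (1 / 8) + - (1 / 8) + (- (1 / 8) + - (1 / 8)))) by field.
  lra.
Qed.

Lemma exp_neg_2_bounds : 13533526 / 100000000 <= exp (- (2)) <= 13533529 / 100000000.
Proof.
  pose proof exp_neg_1_bounds as H; apply square_between in H; [|lra].
  rewrite <- exp_plus in H; replace (- (2)) with (- (1) + - (1)) by ring; lra.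
Qed.

(** * Excluding large asymptotic constants *)

(** The lower bound [outer A] is evaluated where [A e^(-T) = 18/10 T]. If [T <= 22/10], it
    contradicts the upper bound at [T]; otherwise the resulting bound on [Q T] propagates inwards
    and contradicts it at [22/10]. *)
Lemma amplitude_le_5 (Q : R -> R) (A : R) : is_ground_state_profile Q -> 0 < A ->
  (forall t, 0 < t -> t * Q t <= A * exp (- t)) ->
  vanishes (fun t => t * Q t * exp t - A) -> A <= 5.
Proof.
  intros HQ HA Hle Hlim; apply Rnot_lt_le; intros H5.
  pose proof (ground_state_reduced Q HQ) as Hr.
  pose proof (profile_ge_outer _ _ A Hr HA Hle Hlim) as Htail; cbv beta in Htail.
  pose proof (fun T => reduced_profile_upper_bound _ _ T Hr) as Hup; cbv beta in Hup.
  (* The level [18/10] lies below [5 / e], so that [A > 5] forces the crossing to the right of 1. *)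
  assert (HT : exists T, 1 <= T /\ A * exp (- T) = 18 / 10 * T).
  { destruct (IVT_gen (fun t => 18 / 10 * t - A * exp (- t)) 1 A 0) as [T [HT1 HT2]].
    - intros t; apply continuity_pt_filterlim.
      eapply (is_derive_continuous (fun t => 18 / 10 * t - A * exp (- t)) t).
      auto_derive; [exact I|reflexivity].
    - pose proof exp_neg_1_bounds.
      assert (exp (- A) < 1) by (rewrite <- exp_0; apply exp_increasing; lra).
      rewrite Rmin_left, Rmax_right by nra; nra.
    - rewrite Rmin_left in HT1 by lra; exists T; lra. }
  destruct HT as [T [HT1 HT2]].
  assert (HQT : 18 / 10 * (1 - 324 / 100 * (T / (8 * T + 11))) <= Q T).
  { specialize (Htail T ltac:(lra)); unfold outer in Htail.
    replace (A ^ 3 * exp (- (3 * T))) with ((A * exp (- T)) ^ 3) in Htail.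
    2:{ replace (- (3 * T)) with (- T + - T + - T) by ring; rewrite !exp_plus; ring. }
    rewrite HT2 in Htail.
    apply Rmult_le_reg_l with T; [lra|].
    eapply Rle_trans; [|exact Htail]; right; field; nra. }
  assert (Hfrac : forall b, T <= b -> T / (8 * T + 11) <= b / (8 * b + 11)).
  { intros b Hb; apply Rminus_le_0.
    replace (b / (8 * b + 11) - T / (8 * T + 11))
      with (11 * (b - T) / ((8 * b + 11) * (8 * T + 11))) by (field; lra).
    apply Rdiv_le_0_compat; nra. }
  (* On a cell [[a, b]] the upper bound is largest at [b], while the lower bound on [T Q(T)] is
     estimated with [a] for the factor [T] and [b] in the increasing fraction. *)
  assert (Hcase : forall a b, 1 <= a -> a <= T <= b ->
     121 / 100 + 184 / 1000 * b ^ 2 + 47 / 10000 * b ^ 4 <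
     a * (18 / 10 * (1 - 324 / 100 * (b / (8 * b + 11)))) -> False).
  { intros a b Ha HTb Hnum; specialize (Hfrac b ltac:(lra)).
    specialize (Hup T ltac:(lra)).
    assert (T ^ 2 <= b ^ 2) by (apply pow_incr; lra).
    assert (T ^ 4 <= b ^ 4) by (apply pow_incr; lra).
    assert (a * (18 / 10 * (1 - 324 / 100 * (b / (8 * b + 11)))) <= T * Q T); [|lra].
    assert (b / (8 * b + 11) <= 1 / 8).
    { apply Rmult_le_reg_r with (8 * b + 11); [lra|].
      replace (b / (8 * b + 11) * (8 * b + 11)) with b by (field; lra); lra. }
    apply Rmult_le_compat; lra. }
  assert (HT22 : 22 / 10 < T).
  { apply Rnot_le_lt; intros H22.
    destruct (Rle_dec T (105 / 100)); [apply (Hcase 1 (105 / 100)); lra|].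
    destruct (Rle_dec T (112 / 100)); [apply (Hcase (105 / 100) (112 / 100)); lra|].
    destruct (Rle_dec T (123 / 100)); [apply (Hcase (112 / 100) (123 / 100)); lra|].
    destruct (Rle_dec T (140 / 100)); [apply (Hcase (123 / 100) (140 / 100)); lra|].
    destruct (Rle_dec T (165 / 100)); [apply (Hcase (140 / 100) (165 / 100)); lra|].
    destruct (Rle_dec T (195 / 100)); [apply (Hcase (165 / 100) (195 / 100)); lra|].
    apply (Hcase (195 / 100) (22 / 10)); lra. }
  assert (HQ1 : 107 / 100 <= Q T).
  { assert (T / (8 * T + 11) <= 1 / 8); [|lra].
    apply Rmult_le_reg_r with (8 * T + 11); [lra|].
    replace (T / (8 * T + 11) * (8 * T + 11)) with T by (field; lra); lra. }
  pose proof (ground_state_lower_bound Q (107 / 100) T HQ ltac:(lra) ltac:(lra) HQ1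
    (22 / 10) ltac:(lra)).
  specialize (Hup (22 / 10) ltac:(lra)); lra.
Qed.

(** * The sharp bound at [t = 1/2] *)

(* [inner_profile (4 t^2) / 10^5] is a fit of the ground state [Q t], and
   [t * inner_weight (4 t^2)] one of the regular solution of the equation linearised
   at [Q], whose first zero is close to [1/2]. *)
Definition inner_profile : list Z := [431596; -284570; 98040]%Z.

Definition inner_weight : list Z := pmul [1; -1]%Z
  [1000000; -1286758; 1203098; -908130; 577976; -314684; 138657; -42604; 6523]%Z.

(* [t^3 * inner_primitive (4 t^2)] majorises a primitive of the constant term
   in the tangent inequality for the cube. *)
Definition inner_primitive : list Z :=
  [5359707; -13714807; 20670407; -22800681; 20124824; -14977264; 9690962; -5528565;
   2776528; -1209786; 446240; -134856; 31983; -5589; 645; -37]%Z.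

(** For the weight [w = t c(y)] with [y = 4 t^2], this is [(w'' - w + 3 s^2 w) / t] times [10^10],
    where [s] is the fitted profile. Its sign lets the terms linear in [u] be dropped. *)
Definition inner_operator : list Z :=
  let c := inner_weight in
  padd (pscal 10000000000
          (padd (pscal 24 (pder c)) (padd (pscal 16 (0%Z :: pder (pder c))) (pscal (-1) c))))
       (pscal 3 (pmul (pmul inner_profile inner_profile) c)).

(** Up to the scale [10^15], the derivative of [10 t^3 m(y)] minus the constant term [2 t^2 c s^3],
    divided by [t^2]; here [m] is [inner_primitive]. *)
Definition inner_constant : list Z :=
  padd (pscal 10000000000000000
          (padd (pscal 3 inner_primitive) (pscal 2 (0%Z :: pder inner_primitive))))
       (pscal (-2) (pmul inner_weight
          (pmul inner_profile (pmul inner_profile inner_profile)))).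

Lemma inner_checks :
  nonneg01 inner_weight = true /\ nonneg01 inner_profile = true /\
  nonneg01 inner_operator = true /\ nonneg01 inner_constant = true.
Proof. vm_compute; repeat split. Qed.

Lemma reduced_profile_half (u u1 : R -> R) :
  reduced_profile u u1 -> u (1 / 2) <= 12192 / 10000.
Proof.
  intros [H0 Hd Hc Ho Hpos _].
  destruct inner_checks as [Hw [Hs [Hop Hco]]].
  set (c := peval inner_weight); set (c1 := peval (pder inner_weight)).
  set (c2 := peval (pder (pder inner_weight))).
  set (m := peval inner_primitive); set (m1 := peval (pder inner_primitive)).
  assert (Dc : forall y, is_derive c y (c1 y)) by (intros; apply is_derive_peval).
  assert (Dc1 : forall y, is_derive c1 y (c2 y)) by (intros; apply is_derive_peval).
  assert (Dm : forall y, is_derive m y (m1 y)) by (intros; apply is_derive_peval).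
  (* This is [w' u - w u'] for the weight [w = t c(4 t^2)], plus the majorising primitive. *)
  set (f := fun t => (c (4 * t ^ 2) + 8 * t ^ 2 * c1 (4 * t ^ 2)) * u t
    - t * c (4 * t ^ 2) * u1 t + 10 * (t ^ 3 * m (4 * t ^ 2))).
  assert (Hf : f 0 <= f (1 / 2)).
  { apply (nondecreasing_of_derive f (fun t =>
      t * (24 * c1 (4 * t ^ 2) + 64 * t ^ 2 * c2 (4 * t ^ 2) - c (4 * t ^ 2)) * u t
      + t * c (4 * t ^ 2) * (u t ^ 3 / t ^ 2)
      + 10 * (t ^ 2 * (3 * m (4 * t ^ 2) + 8 * t ^ 2 * m1 (4 * t ^ 2))))); [lra| | |].
    - intros t _; unfold f.
      apply (continuous_plus (fun t => (c (4 * t ^ 2) + 8 * t ^ 2 * c1 (4 * t ^ 2)) * u t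
         - t * c (4 * t ^ 2) * u1 t)).
      + apply (continuous_minus
          (fun t => (c (4 * t ^ 2) + 8 * t ^ 2 * c1 (4 * t ^ 2)) * u t)).
        * eapply (is_derive_continuous _ t); auto_derive;
            [repeat split; eexists; [apply Dc|apply Dc1|apply Hd]|reflexivity].
        * apply (continuous_mult (fun t => t * c (4 * t ^ 2))); [|apply Hc].
          eapply (is_derive_continuous _ t); auto_derive; [eexists; apply Dc|reflexivity].
      + eapply (is_derive_continuous _ t); auto_derive; [eexists; apply Dm|reflexivity].
    - intros t Ht; assert (Ht0 : 0 < t) by lra; unfold f; auto_derive.
      + repeat split; eexists; [apply Dc|apply Dc1|apply Hd|apply Dc|apply Ho, Ht0|apply Dm].
      + change (t * (t * 1)) with (t ^ 2).
        rewrite_derive (Dc (4 * t ^ 2)); rewrite_derive (Dc1 (4 * t ^ 2)).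
        rewrite_derive (Dm (4 * t ^ 2)).
        rewrite_derive (Hd t); rewrite_derive (Ho t Ht0); field; lra.
    - intros t Ht; set (y := 4 * t ^ 2); assert (Hy : 0 <= y <= 1) by (unfold y; nra).
      apply (fun H => nonneg01_correct _ y H Hy) in Hw.
      apply (fun H => nonneg01_correct _ y H Hy) in Hs.
      apply (fun H => nonneg01_correct _ y H Hy) in Hop.
      apply (fun H => nonneg01_correct _ y H Hy) in Hco.
      unfold inner_operator in Hop; unfold inner_constant in Hco; cbv zeta in Hop.
      peval_expand Hop; peval_expand Hco.
      fold c2 in Hop; fold m1 in Hco.
      fold c in Hw, Hop, Hco; fold c1 in Hop; fold m in Hco.
      set (s := peval inner_profile y) in *.
      pose proof (Hpos t ltac:(lra)) as Hu.
      pose proof (cube_tangent (u t / t) (s / 100000)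
        ltac:(left; apply Rdiv_lt_0_compat; lra) ltac:(lra)) as Ht3.
      replace (8 * t ^ 2) with (2 * y) by (unfold y; ring).
      replace (64 * t ^ 2) with (16 * y) by (unfold y; ring).
      replace (u t ^ 3 / t ^ 2) with (t * (u t / t) ^ 3) by (field; lra).
      apply (Rmult_le_compat_l (t * c y * t)) in Ht3;
        [|apply Rmult_le_pos; [apply Rmult_le_pos|]; lra].
      assert (P1 : 0 <= u t * t * (24 * c1 y + 16 * y * c2 y - c y
                     + 3 * (s / 100000) ^ 2 * c y)).
      { apply Rmult_le_pos; [apply Rmult_le_pos; lra|]; lra. }
      assert (P2 : 0 <= t ^ 2 * (10 * (3 * m y + 2 * y * m1 y)
                     - 2 * c y * (s / 100000) ^ 3)).
      { apply Rmult_le_pos; [apply pow2_ge_0|]; lra. }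
      replace (t * c y * t * (3 * (s / 100000) ^ 2 * (u t / t) - 2 * (s / 100000) ^ 3))
        with (u t * t * (3 * (s / 100000) ^ 2 * c y) - t ^ 2 * (2 * c y * (s / 100000) ^ 3))
        in Ht3 by (field; lra).
      lra. }
  (* At [1/2] the weight vanishes, and [f 0 <= f (1/2)] reads [0 <= - 2 * 374078 u(1/2) + 10 *
     729711 / 8]. *)
  unfold f in Hf; rewrite H0 in Hf.
  replace (4 * (1 / 2) ^ 2) with 1 in Hf by field.
  assert (Ec : c 1 = IZR 0) by (unfold c; rewrite peval_1; apply f_equal; reflexivity).
  assert (Ec1 : c1 1 = IZR (-374078))
    by (unfold c1; rewrite peval_1; apply f_equal; reflexivity).
  assert (Em : m 1 = IZR 729711) by (unfold m; rewrite peval_1; apply f_equal; reflexivity).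
  rewrite Ec, Ec1, Em in Hf; lra.
Qed.

(** * Comparison with an approximate profile outside [t = 1/2] *)

(* For [d = u - v] with [v'' <= v - v^3/t^2], [d'' >= (1 - V) d] where
   [V = (u^2 + u v + v^2) / t^2], and [V] grows with [u]. *)
Lemma comparison_inequality (t u v v2 z p p2 : R) :
  0 < t -> 0 < u -> u <= z -> - v <= 2 * u -> 0 < p -> 0 < u - v ->
  v2 <= v - v ^ 3 / t ^ 2 ->
  p2 <= p * (1 - (z ^ 2 + z * v + v ^ 2) / t ^ 2) ->
  p2 * (u - v) <= p * (u - u ^ 3 / t ^ 2 - v2).
Proof.
  intros Ht Hu Hz Hv Hp Hd Hv2 Hp2.
  assert (Hi : 0 < / t ^ 2) by (apply Rinv_0_lt_compat, pow_lt, Ht).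
  unfold Rdiv in *; set (i := / t ^ 2) in *.
  assert (HV : (u ^ 2 + u * v + v ^ 2) * i <= (z ^ 2 + z * v + v ^ 2) * i).
  { apply Rmult_le_compat_r; [lra|]; assert (0 <= (z - u) * (z + u + v)); nra. }
  assert (H1 : p2 <= p * (1 - (u ^ 2 + u * v + v ^ 2) * i)) by nra.
  apply (Rmult_le_compat_r (u - v)) in H1; [|lra].
  eapply Rle_trans; [exact H1|].
  replace (p * (1 - (u ^ 2 + u * v + v ^ 2) * i) * (u - v))
    with (p * (u - u ^ 3 * i - (v - v ^ 3 * i))) by ring.
  apply Rmult_le_compat_l; lra.
Qed.

(* Polynomial comparison functions in the variable [x = k (t - 1)], where
   [t = W(x) / h]; the factor [h^2 = k^2] comes from differentiating twice. *)
Definition supersolution_poly (h Dv : Z) (V W : list Z) : list Z :=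
  padd (pscal (Dv * Dv) (pmul (pmul W W)
          (padd V (pscal (- (h * h)) (pder (pder V))))))
       (pscal (- (h * h)) (pmul V (pmul V V))).

Definition weight_poly (h Dv Dz : Z) (V P U W : list Z) : list Z :=
  padd (pscal (Dz * Dz * (Dv * Dv)) (pmul (pmul W W)
          (padd P (pscal (- (h * h)) (pder (pder P))))))
       (pscal (- (h * h)) (pmul P
          (padd (pscal (Dv * Dv) (pmul U U))
             (padd (pscal (Dz * Dv) (pmul U V)) (pscal (Dz * Dz) (pmul V V)))))).

(** The test of [P - 1] provides strict positivity of the weight. *)
Definition comparison_check (h Dv Dz : Z) (V P U W : list Z) : bool :=
  nonneg01 V && nonneg01 (padd P [-1]%Z) &&
  nonneg01 (supersolution_poly h Dv V W) && nonneg01 (weight_poly h Dv Dz V P U W).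

Lemma is_derive_peval_affine (l : list Z) (k t : R) :
  is_derive (fun t => peval l (k * (t - 1))) t (k * peval (pder l) (k * (t - 1))).
Proof.
  auto_derive; [eexists; apply is_derive_peval|].
  rewrite_derive (is_derive_peval l (k * (t + - (1)))); unfold Rminus; ring.
Qed.

Lemma is_derive_div_const (f : R -> R) (t l c : R) :
  is_derive f t l -> is_derive (fun t => f t / c) t (l / c).
Proof.
  intros H; auto_derive; [eexists; exact H|].
  rewrite_derive H; unfold Rdiv; ring.
Qed.

(** One link of a backward chain: positivity of [u - v] and the Wronskian sign pass from [b] to [a].
    A negative [k] lets [x] run against [t]. *)
Lemma comparison_step (u u1 : R -> R) (k h Dv Dz : Z) (V P U W : list Z) (a b : R) :
  reduced_profile u u1 -> 0 < a -> a <= b ->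
  (0 < h)%Z -> (0 < Dv)%Z -> (0 < Dz)%Z -> (k * k = h * h)%Z ->
  comparison_check h Dv Dz V P U W = true ->
  (forall t, a <= t <= b -> 0 <= IZR k * (t - 1) <= 1) ->
  (forall t, a <= t <= b -> peval W (IZR k * (t - 1)) = IZR h * t) ->
  (forall t, a <= t <= b -> u t <= peval U (IZR k * (t - 1)) / IZR Dz) ->
  let v t := peval V (IZR k * (t - 1)) / IZR Dv in
  let v1 t := IZR k * peval (pder V) (IZR k * (t - 1)) / IZR Dv in
  let p t := peval P (IZR k * (t - 1)) in
  let p1 t := IZR k * peval (pder P) (IZR k * (t - 1)) in
  0 < u b - v b -> (u1 b - v1 b) * p b <= p1 b * (u b - v b) ->
  0 < u a - v a /\ (u1 a - v1 a) * p a <= p1 a * (u a - v a).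
Proof.
  intros Hr Ha Hab Hh HDv HDz Hkh Hcheck Hx HW HZ v v1 p p1 Hb1 Hb2.
  apply IZR_lt in Hh, HDv, HDz; apply (f_equal IZR) in Hkh; rewrite !mult_IZR in Hkh.
  apply andb_prop in Hcheck; destruct Hcheck as [Hcheck C4].
  apply andb_prop in Hcheck; destruct Hcheck as [Hcheck C3].
  apply andb_prop in Hcheck; destruct Hcheck as [C1 C2].
  assert (Hp : forall t, a <= t <= b -> 0 < p t).
  { intros t Ht; pose proof (nonneg01_correct _ _ C2 (Hx t Ht)) as H.
    rewrite peval_padd in H; simpl in H; unfold p; lra. }
  apply (sturm_backward (fun t => u t - v t) (fun t => u1 t - v1 t)
    (fun t => u t - u t ^ 3 / t ^ 2
       - IZR h * IZR h * peval (pder (pder V)) (IZR k * (t - 1)) / IZR Dv)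
    p p1 (fun t => IZR h * IZR h * peval (pder (pder P)) (IZR k * (t - 1))) a b); auto.
  - intros t Ht; apply (is_derive_minus u); [apply (rp_derive _ _ Hr)|].
    apply is_derive_div_const, is_derive_peval_affine.
  - intros t Ht; apply (is_derive_minus u1); [apply (rp_ode _ _ Hr); lra|].
    apply (is_derive_div_const (fun t => IZR k * peval (pder V) (IZR k * (t - 1)))).
    rewrite <- Hkh, Rmult_assoc; apply is_derive_scal, is_derive_peval_affine.
  - intros t Ht; apply is_derive_peval_affine.
  - intros t Ht; rewrite <- Hkh, Rmult_assoc.
    apply is_derive_scal, is_derive_peval_affine.
  - intros t Ht Hd.
    assert (Ht' : a <= t <= b) by lra.
    specialize (Hx t Ht'); specialize (HW t Ht'); specialize (HZ t Ht').
    specialize (Hp t Ht').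
    pose proof (rp_pos _ _ Hr t ltac:(lra)) as Hu.
    apply (fun H => nonneg01_correct _ _ H Hx) in C1.
    apply (fun H => nonneg01_correct _ _ H Hx) in C3.
    apply (fun H => nonneg01_correct _ _ H Hx) in C4.
    unfold supersolution_poly in C3; unfold weight_poly in C4.
    peval_expand C3; peval_expand C4.
    rewrite ?opp_IZR, !mult_IZR, HW in C3; rewrite ?opp_IZR, !mult_IZR, HW in C4.
    unfold v, v1, p, p1 in *.
    set (x := IZR k * (t - 1)) in *.
    set (Vx := peval V x) in *; set (Px := peval P x) in *; set (Zx := peval U x) in *.
    set (V2 := peval (pder (pder V)) x) in *; set (P2 := peval (pder (pder P)) x) in *.
    set (H := IZR h) in *; set (E := IZR Dv) in *; set (F := IZR Dz) in *.
    assert (Ht0 : 0 < t) by lra.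
    assert (0 <= Vx / E) by (apply Rdiv_le_0_compat; lra).
    apply (comparison_inequality t (u t) (Vx / E) _ (Zx / F)); try lra.
    + apply Rminus_le_0.
      replace (Vx / E - (Vx / E) ^ 3 / t ^ 2 - H * H * V2 / E) with
        ((E * E * (H * t * (H * t) * (Vx + - (H * H) * V2)) + - (H * H) * (Vx * (Vx * Vx)))
          / (H ^ 2 * E ^ 3 * t ^ 2)) by (field; lra).
      apply Rdiv_le_0_compat; [exact C3|].
      repeat apply Rmult_lt_0_compat; try apply pow_lt; lra.
    + apply Rminus_le_0.
      replace (Px * (1 - ((Zx / F) ^ 2 + Zx / F * (Vx / E) + (Vx / E) ^ 2) / t ^ 2)
                - H * H * P2) with
        ((F * F * (E * E) * (H * t * (H * t) * (Px + - (H * H) * P2)) + - (H * H) * (Px *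
           (E * E * (Zx * Zx) + (F * E * (Zx * Vx) + F * F * (Vx * Vx)))))
          / (H ^ 2 * E ^ 2 * F ^ 2 * t ^ 2)) by (field; lra).
      apply Rdiv_le_0_compat; [exact C4|].
      repeat apply Rmult_lt_0_compat; try apply pow_lt; lra.
Qed.

(* Numerical fits of the solution asymptotic to [2.714 e^{-t}] and of a positive
   Sturm weight, on [1/2, 1] in [x = 2 - 2 t] and on [1, 2] in [x = t - 1].
   The values are scaled by 5120000000 and 10000000, the bounds on [u] by
   100000000 and 100. *)
Definition near_value : list Z :=
  [4861642752; 2025969920; 59747328; -326369408; -234446336; -97504624; -65574768;
   38225052; -39038486; 19872708]%Z.
Definition near_weight : list Z := [57792; -9824; -25168; -4412; -16322; 10659]%Z.
(** The bound [121/100 + 184/1000 t^2 + 47/10000 t^4] at [t = (2 - x) / 2]. *)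
Definition near_bound : list Z :=
  padd [121000000]%Z (padd (pscal 4600000 (pmul [2; -1]%Z [2; -1]%Z))
    (pscal 29375 (pmul (pmul [2; -1]%Z [2; -1]%Z) (pmul [2; -1]%Z [2; -1]%Z)))).

Definition middle_value : list Z :=
  [9495396; -7913945; 466738; 5103085; -7269686; 6815685; -4879304; 2649955; -1024766;
   248889; -28233]%Z.
Definition middle_weight : list Z := [1806; 614; -4824; 7051; -5876; 2916; -751; 65]%Z.
(** From [5 e^(-t) <= 5 e^(-1) (1 - x + x^2 / 2)] and [5 e^(-1) < 1.84]. *)
Definition middle_bound : list Z := [184; -184; 92]%Z.

Lemma near_check :
  comparison_check 2 5120000000 100000000 near_value near_weight near_bound [2; -1]%Z = true.
Proof. vm_compute; reflexivity. Qed.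

Lemma middle_check :
  comparison_check 1 10000000 100 middle_value middle_weight middle_bound [1; 1]%Z = true.
Proof. vm_compute; reflexivity. Qed.

(** * Comparison from infinity and the sharp amplitude *)

Lemma outer_le (a t : R) : 0 < a -> 0 < t -> outer a t <= a * exp (- t).
Proof.
  intros Ha Ht; unfold outer.
  assert (0 < a ^ 3 * exp (- (3 * t)) / (8 * t ^ 2 + 11 * t)); [|lra].
  apply Rdiv_lt_0_compat; [|nra].
  apply Rmult_lt_0_compat; [apply pow_lt, Ha|apply exp_pos].
Qed.

Lemma outer_nonneg (t : R) : 2 <= t -> 0 <= outer (2714 / 1000) t.
Proof.
  intros Ht; unfold outer.
  replace (exp (- (3 * t))) with (exp (- t) * (exp (- t) * exp (- t)))
    by (rewrite <- !exp_plus; f_equal; ring).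
  assert (He : 0 < exp (- t)) by apply exp_pos.
  assert (He1 : exp (- t) < 1) by (rewrite <- exp_0; apply exp_increasing; lra).
  assert (HP : 54 <= 8 * t ^ 2 + 11 * t) by nra.
  set (E := exp (- t)) in *; set (P := 8 * t ^ 2 + 11 * t) in *.
  replace (2714 / 1000 * E - (2714 / 1000) ^ 3 * (E * (E * E)) / P)
    with (2714 / 1000 * E * ((P - (2714 / 1000) ^ 2 * (E * E)) / P)) by (field; lra).
  apply Rmult_le_pos; [lra|]; apply Rdiv_le_0_compat; [|lra].
  assert (E * E <= 1) by nra; lra.
Qed.

Lemma cube_incr (x y : R) : x <= y -> x ^ 3 <= y ^ 3.
Proof.
  intros H; assert (0 <= (y - x) * (y ^ 2 + x * y + x ^ 2)); [|lra].
  apply Rmult_le_pos; [lra|]; assert (0 <= (y + x) ^ 2 + y ^ 2 + x ^ 2); nra.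
Qed.

(** On [[2, oo)] the bound [5 e^(-t)] keeps the potential below [9/40 < 1 - (88/100)^2], so
    [e^(-0.88 t)] is an admissible Sturm weight. *)
Lemma outer_comparison (u u1 : R -> R) (A : R) : reduced_profile u u1 ->
  (forall t, 0 < t -> u t <= 5 * exp (- t)) ->
  vanishes (fun t => u t * exp t - A) -> 2714 / 1000 < A ->
  0 < u 2 - outer (2714 / 1000) 2 /\
  u1 2 - outer1 (2714 / 1000) 2 <= - (88 / 100) * (u 2 - outer (2714 / 1000) 2).
Proof.
  intros Hr H5 Hlim HA; set (a := 2714 / 1000) in *.
  destruct (reduced_profile_vanishes u u1 Hr) as [Hv Hv1].
  destruct (outer_vanishes a) as [Tv [Tv1 Tlim]].
  set (d := fun t => u t - outer a t); set (d1 := fun t => u1 t - outer1 a t).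
  set (d2 := fun t => u t - u t ^ 3 / t ^ 2 - outer2 a t).
  set (p := fun t => exp (- (88 / 100 * t))).
  set (p1 := fun t => - (88 / 100) * exp (- (88 / 100 * t))).
  set (p2 := fun t => 7744 / 10000 * exp (- (88 / 100 * t))).
  assert (Dd : forall t, 2 <= t -> is_derive d t (d1 t)).
  { intros t Ht; apply (is_derive_minus u);
      [apply (rp_derive _ _ Hr)|apply is_derive_outer; lra]. }
  assert (Dd1 : forall t, 2 <= t -> is_derive d1 t (d2 t)).
  { intros t Ht; apply (is_derive_minus u1);
      [apply (rp_ode _ _ Hr)|apply is_derive_outer1]; lra. }
  assert (Dp : forall t, is_derive p t (p1 t))
    by (intros t; unfold p, p1; auto_derive; [exact I|field]).
  assert (Dp1 : forall t, is_derive p1 t (p2 t))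
    by (intros t; unfold p1, p2; auto_derive; [exact I|field]).
  assert (Hp : forall t, 0 < p t) by (intros; apply exp_pos).
  assert (Hineq : forall t, 2 <= t -> 0 < d t -> p2 t * d t <= p t * d2 t).
  { intros t Ht Hd; pose proof (rp_pos _ _ Hr t ltac:(lra)) as Hu.
    pose proof (outer_nonneg t Ht) as Ho; fold a in Ho.
    pose proof (outer_le a t ltac:(unfold a; lra) ltac:(lra)) as Hle.
    assert (Hi : 0 < / t ^ 2) by (apply Rinv_0_lt_compat, pow_lt; lra).
    pose proof (H5 t ltac:(lra)) as Hu5.
    apply (comparison_inequality t (u t) (outer a t) _ (5 * exp (- t))); auto; try lra.
    - pose proof (outer_supersolution a t ltac:(unfold a; lra) ltac:(lra)) as Hs.
      pose proof (cube_incr _ _ Hle) as Hc.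
      apply (Rmult_le_compat_r (/ t ^ 2)) in Hc; [|lra].
      unfold Rdiv in *; rewrite Ropp_mult_distr_l_reverse in Hs; lra.
    - assert (He : exp (- t) <= 13533529 / 100000000).
      { pose proof exp_neg_2_bounds.
        destruct Ht as [Ht| <-]; [|lra].
        pose proof (exp_increasing (- t) (- (2)) ltac:(lra)); lra. }
      assert (He0 : 0 < exp (- t)) by apply exp_pos.
      assert (Hi4 : / t ^ 2 <= / 4) by (apply Rinv_le_contravar; nra).
      set (E := exp (- t)) in *.
      assert (HV : (5 * E) ^ 2 + 5 * E * outer a t + outer a t ^ 2 <= 9 / 10).
      { unfold a in *; nra. }
      unfold p2, p, Rdiv.
      assert (((5 * E) ^ 2 + 5 * E * outer a t + outer a t ^ 2) * / t ^ 2 <= 9 / 10 * / 4).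
      { apply Rmult_le_compat; try lra.
        apply Rplus_le_le_0_compat; [|apply pow2_ge_0].
        apply Rplus_le_le_0_compat; [apply pow2_ge_0|].
        apply Rmult_le_pos; lra. }
      set (K := ((5 * E) ^ 2 + 5 * E * outer a t + outer a t ^ 2) * / t ^ 2) in *.
      pose proof (exp_pos (- (88 * / 100 * t))); nra. }
  (* [d e^t] tends to [A - a > 0]. *)
  assert (Hev : exists M, 2 <= M /\ forall t, M <= t -> 0 < d t).
  { destruct (vanishes_minus _ _ Hlim Tlim (A - a)) as [M HM]; [lra|].
    exists (Rmax 2 M); split; [apply Rmax_l|]; intros t Ht.
    specialize (HM t ltac:(pose proof (Rmax_r 2 M); lra)).
    apply Rabs_def2 in HM; destruct HM as [_ HM].
    unfold d; pose proof (exp_pos t); nra. }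
  destruct Hev as [M [HM2 HM]].
  (* On [[M, oo)] the Wronskian is nondecreasing and tends to 0; this supplies the starting data at
     [M] for the backward comparison. *)
  assert (HN : p M * d1 M - p1 M * d M <= 0).
  { apply (nondecreasing_vanishes_le_0 (fun t => p t * d1 t - p1 t * d t)
      (fun t => p t * d2 t - p2 t * d t)).
    - intros t Ht; assert (Ht2 : 2 <= t) by lra; auto_derive.
      + repeat split; eexists; [apply Dp|apply Dd1, Ht2|apply Dp1|apply Dd, Ht2].
      + rewrite_derive (Dp t); rewrite_derive (Dd1 t Ht2).
        rewrite_derive (Dp1 t); rewrite_derive (Dd t Ht2); ring.
    - intros t Ht; specialize (Hineq t ltac:(lra) (HM t ltac:(lra))); lra.
    - apply (vanishes_ext (fun t => p t * (d1 t + 88 / 100 * d t)) _ 0);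
        [intros; unfold p, p1; ring|].
      apply (vanishes_mult_bounded _ _ 1 0).
      + intros t Ht; unfold p; rewrite Rabs_pos_eq by (left; apply exp_pos).
        destruct Ht as [Ht| <-]; [|rewrite Rmult_0_r, Ropp_0, exp_0; lra].
        left; rewrite <- exp_0; apply exp_increasing; lra.
      + apply vanishes_plus; [apply vanishes_minus; assumption|].
        apply vanishes_scal, vanishes_minus; assumption. }
  destruct (sturm_backward d d1 d2 p p1 p2 2 M) as [R1 R2]; auto.
  - intros t Ht; apply Dd; lra.
  - intros t Ht; apply Dd1; lra.
  - intros t Ht; apply Hineq; lra.
  - apply HM; lra.
  - lra.
  - split; [exact R1|].
    apply Rmult_le_reg_r with (p 2); [apply Hp|].
    eapply Rle_trans; [exact R2|]; right; unfold p, p1, d; ring.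
Qed.

Lemma middle_bound_correct (u : R -> R) : (forall t, 0 < t -> u t <= 5 * exp (- t)) ->
  forall t, 1 <= t <= 2 -> u t <= peval middle_bound (IZR 1 * (t - 1)) / IZR 100.
Proof.
  intros H5 t Ht; specialize (H5 t ltac:(lra)); unfold middle_bound; simpl peval.
  replace (- t) with (- (1) + - (t - 1)) in H5 by ring; rewrite exp_plus in H5.
  pose proof exp_neg_1_bounds as H1; pose proof (exp_neg_le_2 (t - 1) ltac:(lra)) as H2.
  pose proof (exp_pos (- (t - 1))) as H3.
  assert (exp (- (1)) * exp (- (t - 1)) <=
    36787945 / 100000000 * (1 - (t - 1) + (t - 1) ^ 2 / 2)) by (apply Rmult_le_compat; lra).
  nra.
Qed.

Lemma near_bound_correct (u u1 : R -> R) : reduced_profile u u1 ->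
  forall t, 1 / 2 <= t <= 1 -> u t <= peval near_bound (IZR (-2) * (t - 1)) / IZR 100000000.
Proof.
  intros Hr t Ht.
  pose proof (reduced_profile_upper_bound u u1 t Hr ltac:(lra)) as H.
  eapply Rle_trans; [exact H|]; right; unfold near_bound.
  rewrite !peval_padd, !peval_pscal, !peval_pmul; simpl peval; field.
Qed.

Ltac compute_values H :=
  rewrite ?peval_1, ?peval_0 in H;
  repeat match type of H with
  | context [fold_right Z.add 0%Z ?l] =>
      let x := eval vm_compute in (fold_right Z.add 0%Z l) in
      change (fold_right Z.add 0%Z l) with x in H
  | context [hd 0%Z ?l] =>
      let x := eval vm_compute in (hd 0%Z l) in change (hd 0%Z l) with x in H
  end.

(** The comparisons are chained through 2, 1 and [1/2]. At 1 the two pieces match exactly in value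
    and slope, with proportional weights. *)
Lemma reduced_profile_amplitude (u u1 : R -> R) (A : R) : reduced_profile u u1 ->
  (forall t, 0 < t -> u t <= 5 * exp (- t)) ->
  vanishes (fun t => u t * exp t - A) -> A <= 2714 / 1000.
Proof.
  intros Hr H5 Hlim; apply Rnot_lt_le; intros HA.
  destruct (outer_comparison u u1 A Hr H5 Hlim HA) as [H1 H2].
  pose proof (comparison_step u u1 1 1 10000000 100 middle_value middle_weight
    middle_bound [1; 1]%Z 1 2 Hr ltac:(lra) ltac:(lra) eq_refl eq_refl eq_refl eq_refl
    middle_check ltac:(intros; lra) ltac:(intros; simpl; ring)
    (middle_bound_correct u H5)) as Hmid.
  pose proof (comparison_step u u1 (-2) 2 5120000000 100000000 near_value near_weight
    near_bound [2; -1]%Z (1 / 2) 1 Hr ltac:(lra) ltac:(lra) eq_refl eq_refl eq_refl eq_refl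
    near_check ltac:(intros; lra) ltac:(intros; simpl; ring)
    (near_bound_correct u u1 Hr)) as Hnear.
  cbv beta zeta in Hmid, Hnear.
  replace (IZR 1 * (2 - 1)) with 1 in Hmid by ring.
  replace (IZR 1 * (1 - 1)) with 0 in Hmid by ring.
  replace (IZR (-2) * (1 - 1)) with 0 in Hnear by ring.
  replace (IZR (-2) * (1 / 2 - 1)) with 1 in Hnear by field.
  compute_values Hmid; compute_values Hnear.
  pose proof exp_neg_2_bounds as HE.
  unfold outer, outer1 in H1, H2.
  replace (exp (- (3 * 2))) with (exp (- (2)) ^ 3) in H1, H2
    by (simpl; rewrite Rmult_1_r, <- !exp_plus; f_equal; ring).
  set (E := exp (- (2))) in *.
  assert (HE3 : (13533526 / 100000000) ^ 3 <= E ^ 3 <= (13533529 / 100000000) ^ 3)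
    by (split; apply pow_incr; lra).
  set (E3 := E ^ 3) in *.
  (* At 2 the new comparison function is slightly lower and its slope slightly larger than for
     [outer], and the new weight has logarithmic derivative [-856/1001 > -88/100]; so the Wronskian
     sign survives. *)
  destruct Hmid as [M1 M2]; [lra|lra|].
  destruct Hnear as [N1 N2]; [lra|lra|].
  (* The chain gives [u (1/2) > 1.21924], above the inner bound. *)
  pose proof (reduced_profile_half u u1 Hr); lra.
Qed.

Theorem lemma4p1 (Q : R -> R) (HQ : is_ground_state_profile Q) :
  (forall t, 5 / 2 <= t -> 0 < Q t /\ Q t <= (2714 / 1000) * (1 / t) * exp (- t)) /\
  (forall t, 5 <= t -> 3 * (Q t) ^ 2 <= exp (- (2 * t))).
Proof.
  pose proof (ground_state_reduced Q HQ) as Hr.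
  destruct (scaled_profile_limit _ _ Hr) as [A [HA [Hle Hlim]]]; cbv beta in Hle, Hlim.
  pose proof (amplitude_le_5 Q A HQ HA Hle Hlim) as H5.
  assert (HA2 : A <= 2714 / 1000).
  { apply (reduced_profile_amplitude _ _ A Hr); [|exact Hlim].
    intros t Ht; specialize (Hle t Ht); pose proof (exp_pos (- t)); nra. }
  assert (Hpos : forall t, 0 < t -> 0 < Q t)
    by (intros t Ht; destruct HQ as [_ [_ [_ [Hp _]]]]; apply Hp; lra).
  assert (Hb : forall t, 0 < t -> Q t <= 2714 / 1000 * (1 / t) * exp (- t)).
  { intros t Ht; apply Rmult_le_reg_l with t; [exact Ht|].
    replace (t * (2714 / 1000 * (1 / t) * exp (- t)))
      with (2714 / 1000 * exp (- t)) by (field; lra).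
    specialize (Hle t Ht); pose proof (exp_pos (- t)); nra. }
  split.
  - intros t Ht; split; [apply Hpos|apply Hb]; lra.
  - intros t Ht; specialize (Hb t ltac:(lra)); pose proof (Hpos t ltac:(lra)).
    replace (- (2 * t)) with (- t + - t) by ring; rewrite exp_plus.
    pose proof (exp_pos (- t)) as HE; set (E := exp (- t)) in *.
    assert (Hi : 1 / t <= 1 / 5)
      by (unfold Rdiv; rewrite !Rmult_1_l; apply Rinv_le_contravar; lra).
    (* [5428 / 10000] is [2.714 / 5], and three times its square is below 1. *)
    assert (Hq : Q t <= 5428 / 10000 * E) by nra.
    assert (Q t ^ 2 <= (5428 / 10000 * E) ^ 2) by (apply pow_incr; lra).
    nra.
Qed.
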